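(* Let $K$ be a number field. Let $a_1,a_2,a_3 \in K^\times$ be distinct. Let \[ H = h(a_1) + h(a_2) + h(a_3). \] For all $\xi \in \overline{\mathbb{Q}}$, if $1+a_1\xi$, $1+a_2\xi$ and $1+a_3\xi$ lie in a rank-$1$ subgroup of $\mathbb{G}_m(\overline{\mathbb{Q}})=\overline{\mathbb{Q}}^\times$, then \begin{enumerate} \item[(i)] $h(\xi) < 2708(H+1)$ if $K(\xi)$ is totally real or $[K(\xi):\mathbb{Q}] \leq 3$; \item[(ii)] $h(\xi) < 166\, [K(\xi):\mathbb{Q}]^3 \bigl( \log([K(\xi):\mathbb{Q}]) + 2.5 \bigr) (H+1)$ otherwise. \end{enumerate}
   Context: For $\alpha\in\overline{\mathbb{Q}}$, $h(\alpha)$ denotes the absolute logarithmic Weil height. The rank of an abelian group $A$ is $\dim_{\mathbb{Q}}(A\otimes_{\mathbb{Z}}\mathbb{Q})$. The hypothesis includes that $1+a_i\xi\neq 0$ for each $i$. *)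

(* Defs.v *)
From HB Require Import structures.
From mathcomp Require Import all_boot all_order all_algebra all_field.
From mathcomp Require Import complex finmap.
From mathcomp Require Import all_classical all_reals all_analysis.

Set Implicit Arguments.
Unset Strict Implicit.
Unset Printing Implicit Defensive.

Import Order.TTheory GRing.Theory Num.Theory.

Local Open Scope classical_set_scope.
Local Open Scope ring_scope.

(* Conventions: the field of algebraic numbers is [algC]; the field of complex *)
(* numbers is [R[i]] with [R : realType]; an abstract number field is a        *)
(* [fieldExtType rat].                                                         *)

Definition is_subfield (F : set algC) : Prop :=
  [/\ F 1, (forall x y, F x -> F y -> F (x - y))
     & (forall x y, F x -> F y -> F (x / y))].

Definition adjoin (K : set algC) (xi : algC) : set algC :=
  smallest is_subfield (K `|` [set xi]).

Definition number_field (F : set algC) : Prop :=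
  exists (L : fieldExtType rat) (j : {rmorphism L -> algC}), range j = F.

Definition degree (F : set algC) : nat :=
  xget 0%N [set n | exists (L : fieldExtType rat) (j : {rmorphism L -> algC}),
                      range j = F /\ \dim {:L} = n].

Definition totally_real (R : realType) (F : set algC) : Prop :=
  forall (L : fieldExtType rat) (j : {rmorphism L -> algC}), range j = F ->
  forall (s : {rmorphism L -> R[i]}) (x : L), complex.Im (s x) = 0.

Section Height.
Variables (R : realType) (L : fieldExtType rat).

(* Ring morphisms are recorded as bare functions, which form a [choiceType],  *)
(* as the index type of a finitely supported sum must.                        *)
Definition complex_embeddings : set (L -> R[i]) :=
  [set s | exists f : {rmorphism L -> R[i]}, s = f :> (L -> R[i])].

(* The finite places of L, as normalized discrete valuations, i.e. the        *)
(* [ord_P] for P a nonzero prime of the ring of integers.  The value at 0,    *)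
(* mathematically +oo, is pinned to the junk value 0 so that each place is    *)
(* counted once.                                                              *)
Definition finite_places : set (L -> int) :=
  [set v | [/\ v 0 = 0,
               (forall x y : L, x != 0 -> y != 0 -> v (x * y) = v x + v y),
               (forall x y : L, x != 0 -> y != 0 -> x + y != 0 ->
                  Num.min (v x) (v y) <= v (x + y))
             & (exists2 x : L, x != 0 & v x = 1)]].

Definition valuation_ring (v : L -> int) : set L :=
  [set x | x = 0 \/ 0 <= v x].

Definition valuation_ideal (v : L -> int) : set L :=
  [set x | x = 0 \/ 0 < v x].

Definition residue_classes (v : L -> int) : set (set L) :=
  [set [set y | valuation_ideal v (y - x)] | x in valuation_ring v].

Definition residue_card (v : L -> int) : nat :=
  #|` fset_set (residue_classes v)|.

(* [N(P) ^ (- ord_P x)], i.e. the absolute value extending the p-adic one of  *)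
(* Q, raised to the local degree.                                             *)
Definition place_norm (v : L -> int) (x : L) : R :=
  if x == 0 then 0 else (residue_card v)%:R ^ (- v x).

Definition height_in (x : L) : R :=
  (\sum_(s \in complex_embeddings) ln (Num.max 1 (Normc.normc (s x)))
   + \sum_(v \in finite_places) ln (Num.max 1 (place_norm v x)))
  / (\dim {:L})%:R.

End Height.

(* The value of [height_in] does not depend on the number field containing    *)
(* [alpha]; [num_field_exists [:: alpha]] provides the field generated by it. *)
Definition height (R : realType) (alpha : algC) : R :=
  let: existT L (existT _ (exist2 s _ _)) := num_field_exists [:: alpha] in
  @height_in R L (head 0 s).

Definition biadditive (A B C : zmodType) (b : A -> B -> C) : Prop :=
  (forall x y q, b (x + y) q = b x q + b y q) /\
  (forall x q r, b x (q + r) = b x q + b x r).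

(* V, with the pure tensors given by [t], is the tensor product of A and Q    *)
(* over Z, with Q acting on the second factor.                                *)
Definition is_tensor_rat (A : zmodType) (V : lmodType rat) (t : A -> rat -> V) :
    Prop :=
  [/\ biadditive t,
      (forall x q r, t x (q * r) = q *: t x r)
    & forall (W : zmodType) (b : A -> rat -> W), biadditive b ->
      exists f : {additive V -> W},
        (forall x q, f (t x q) = b x q) /\
        (forall g : {additive V -> W}, (forall x q, g (t x q) = b x q) -> g =1 f)].

Definition has_rank (A : zmodType) (n : nat) : Prop :=
  exists (V : vectType rat) (t : A -> rat -> V),
    is_tensor_rat t /\ \dim {:V} = n.

(* As abelian groups are written additively in the library, a subgroup of the *)
(* multiplicative group is the image of an injective morphism from a          *)
(* [zmodType].                                                                *)
Definition mul_subgroup_of_rank (n : nat) (G : set algC) : Prop :=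
  exists (A : zmodType) (e : A -> algC),
    [/\ (forall x, e x != 0), {morph e : x y / x + y >-> x * y},
        injective e, range e = G & has_rank A n].

(* Main.v *)
(** Put [x = 1 + a1 xi], [y = 1 + a2 xi] and [t = x / y].  In a group of rank one
    there is a relation [x ^ m = y ^ n], so that the heights of [x], [y] and [t]
    are proportional to [|n|], [|m|] and [|n - m|], and the largest of the three
    is the sum of the other two.  Since each of them is [h(xi)] up to a linear
    function of [h(a1)] and [h(a2)], so is [2 h(xi)]; thus [h(xi)] is bounded by
    such a function, independently of the field and of [a3].

    The height calculus takes place in one Galois number field [M].  It rests on
    [sum_(w | p) e_w f_w = [M : Q]].  A family in the intersection of the
    valuation rings above [p] that is maximal among those independent modulo [p]
    has [sum e_w f_w] elements, by weak approximation, and cannot be shorter than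
    a basis because the trace form is nondegenerate.  Averaging over the Galois
    group then gives the product formula, and comparing with a subfield shows
    that the height does not depend on the number field. *)

Require Import Defs.
From HB Require Import structures.
From mathcomp Require Import all_boot all_order all_algebra all_field.
From mathcomp Require Import complex finmap generic_quotient zify ring lra.
From mathcomp Require Import all_classical all_reals all_analysis.

Import Order.TTheory GRing.Theory Num.Theory.
Local Open Scope classical_set_scope.
Local Open Scope ring_scope.

Set Implicit Arguments.
Unset Strict Implicit.
Unset Printing Implicit Defensive.

(** * Discrete valuations *)

(** Finite places are bare functions [L -> int], so the usual facts on prime ideals have to be
    recovered from the valuation axioms: a place exists above every prime, there are finitely many
    of them, and their residue fields are finite. Quotient rings are never formed; they are counted
    through finite families of representatives. The local degree identity therefore appears in the
    exponential form [prod q_w ^ e_w = q_v ^ s], in which only residue cardinalities occur.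
    Independence modulo [p] yields only [s * dim L <= dim M]. Equality is proved for a Galois field
    over the rationals, where the conjugates of a place above [p] are again above [p], so that
    traces of integral elements are integral at [p]; the relative case [L -> M] is then squeezed out
    of the absolute one. The height bound itself comes from comparing one height with a sum of two:
    all three equal [h(xi)] up to a controlled error, so one copy of [h(xi)] is absorbed by the
    error. *)

Definition is_valuation (F : fieldType) (v : F -> int) : Prop :=
  [/\ v 0 = 0,
      (forall x y : F, x != 0 -> y != 0 -> v (x * y) = v x + v y),
      (forall x y : F, x != 0 -> y != 0 -> x + y != 0 ->
         Num.min (v x) (v y) <= v (x + y))
    & (exists2 x : F, x != 0 & v x = 1)].

(* The ball contains 0, although [v 0] is the junk value 0. *)
Definition vball (F : fieldType) (v : F -> int) (k : int) : {pred F} :=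
  [pred x | (x == 0) || (k <= v x)].

Section Valuation.
Variables (F : fieldType) (v : F -> int).
Hypothesis v_val : is_valuation v.

Lemma val0 : v 0 = 0. Proof. by case: v_val. Qed.

Lemma valM x y : x != 0 -> y != 0 -> v (x * y) = v x + v y.
Proof. by case: v_val => _ + _ _; apply. Qed.

Lemma val1 : v 1 = 0.
Proof.
have := valM (oner_neq0 F) (oner_neq0 F).
by rewrite mulr1; move: (v 1) => a; lia.
Qed.

Lemma valX x n : v (x ^+ n) = v x * n%:Z.
Proof.
have [->|x0] := eqVneq x 0.
  by rewrite expr0n val0 mul0r; case: n => //=; rewrite ?val1 ?val0.
elim: n => [|n IH]; first by rewrite val1 mulr0.
by rewrite exprS valM ?expf_neq0 // IH -addn1 PoszD mulrDr mulr1 addrC.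
Qed.

Lemma valN x : v (- x) = v x.
Proof.
have [->|x0] := eqVneq x 0; first by rewrite oppr0.
have : v (-1) = 0.
  have := valX (-1) 2; rewrite sqrrN expr1n val1; lia.
by move=> h; rewrite -mulN1r valM ?oppr_eq0 ?oner_eq0 // h add0r.
Qed.

Lemma valV x : v x^-1 = - v x.
Proof.
have [->|x0] := eqVneq x 0; first by rewrite invr0 val0 oppr0.
have := valM x0 (invr_neq0 x0); rewrite mulfV // val1; lia.
Qed.

Lemma valXz x (n : int) : v (x ^ n) = v x * n.
Proof. by case: n => n; rewrite ?valV valX // NegzE mulrN. Qed.

Lemma vball0 k : 0 \in vball v k. Proof. by rewrite inE eqxx. Qed.

Lemma vball_val x : x \in vball v (v x). Proof. by rewrite inE lexx orbT. Qed.

Lemma vballE x k : x != 0 -> (x \in vball v k) = (k <= v x).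
Proof. by rewrite inE => /negPf ->. Qed.

Lemma vballW k l : l <= k -> {subset vball v k <= vball v l}.
Proof. by move=> lk x; rewrite !inE => /orP[->//|/(le_trans lk) ->]; rewrite orbT. Qed.

Lemma vballD k x y : x \in vball v k -> y \in vball v k -> x + y \in vball v k.
Proof.
rewrite !inE; have [->|x0 /= kx] := eqVneq x 0; first by rewrite add0r.
have [->|y0 /= ky] := eqVneq y 0; first by rewrite addr0 kx orbT.
have [//|xy0 /=] := eqVneq (x + y) 0.
case: v_val => _ _ /(_ x y x0 y0 xy0) + _; apply: le_trans.
by rewrite le_min kx ky.
Qed.

Lemma vballN k x : (- x \in vball v k) = (x \in vball v k).
Proof. by rewrite !inE oppr_eq0 valN. Qed.

Lemma vballB k x y : x \in vball v k -> y \in vball v k -> x - y \in vball v k.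
Proof. by move=> kx ky; rewrite vballD ?vballN. Qed.

Lemma vballM k l x y :
  x \in vball v k -> y \in vball v l -> x * y \in vball v (k + l).
Proof.
rewrite !inE; have [->|x0 /= kx] := eqVneq x 0; first by rewrite mul0r eqxx.
have [->|y0 /= ky] := eqVneq y 0; first by rewrite mulr0 eqxx.
by rewrite valM // lerD // orbT.
Qed.

Lemma vball_sum k (I : Type) (r : seq I) (P : pred I) (f : I -> F) :
  (forall i, P i -> f i \in vball v k) -> \sum_(i <- r | P i) f i \in vball v k.
Proof. by move=> h; elim/big_ind: _ => //; [exact: vball0 | exact: vballD]. Qed.

Lemma vball1 : 1 \in vball v 0.
Proof. by rewrite inE val1 orbT. Qed.

Lemma vball_nat n : n%:R \in vball v 0.
Proof. by elim: n => [|n IH]; rewrite ?vball0 // -addn1 natrD vballD ?vball1. Qed.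

(** If the valuation of the sum were larger, [x = (x + y) - y] would lie in the ball of index
    [v x + 1]. *)
Lemma valD_lt x y : x != 0 -> y \in vball v (v x + 1) -> v (x + y) = v x /\ x + y != 0.
Proof.
move=> x0 hy.
have xy0 : x + y != 0.
  apply/eqP => /eqP; rewrite addr_eq0 => /eqP xy; move: hy.
  by rewrite -vballN -xy vballE //; lia.
split=> //; apply/eqP; rewrite eq_le; apply/andP; split.
  rewrite leNgt; apply/negP => h.
  have : (x + y) - y \in vball v (v x + 1).
    by apply: vballB => //; rewrite vballE // lezD1.
  by rewrite addrK vballE //; lia.
by rewrite -vballE // vballD ?vball_val //; apply: vballW hy; lia.
Qed.

Lemma vball_mul_val x y k : x != 0 ->
  (x * y \in vball v (v x + k)) = (y \in vball v k).
Proof.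
move=> x0; have [->|y0] := eqVneq y 0; first by rewrite mulr0 !vball0.
by rewrite !vballE ?mulf_neq0 // valM // lerD2l.
Qed.

Lemma uniformizer : exists2 x, x != 0 & v x = 1.
Proof. by case: v_val. Qed.

End Valuation.

(** * Counting quotients through representatives *)

(** A transversal of [A / B]. The sets are mere predicates, so balls and intersections of balls can
    be used without a subgroup structure; the closure properties are supplied where they matter. *)
Definition reps (F : zmodType) (A B : {pred F}) (T : finType) (r : T -> F) : Prop :=
  [/\ (forall t, r t \in A),
      (forall t u, r t - r u \in B -> t = u)
    & (forall x, x \in A -> exists t, x - r t \in B)].

Section Reps.
Variable F : zmodType.
Implicit Types A B C : {pred F}.

Lemma reps_card_le A B (T U : finType) (r : T -> F) (s : U -> F) :
  (forall x y, x \in B -> y \in B -> x - y \in B) ->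
  (forall t, r t \in A) -> (forall t u, r t - r u \in B -> t = u) ->
  (forall x, x \in A -> exists t, x - s t \in B) -> (#|T| <= #|U|)%N.
Proof.
move=> subB rA r_inj s_onto.
have /choice[f hf] : forall t, exists u, r t - s u \in B by move=> t; apply: s_onto.
apply: (leq_card f) => t u ftu; apply: r_inj.
have := subB _ _ (hf t) (hf u); rewrite ftu.
by rewrite opprB subrKA.
Qed.

Lemma reps_card A B (T U : finType) (r : T -> F) (s : U -> F) :
  (forall x y, x \in B -> y \in B -> x - y \in B) ->
  reps A B r -> reps A B s -> #|T| = #|U|.
Proof.
move=> subB [r1 r2 r3] [s1 s2 s3]; apply/eqP; rewrite eqn_leq.
by rewrite (reps_card_le subB r1 r2 s3) (reps_card_le subB s1 s2 r3).
Qed.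

Lemma reps_tower A B C (T U : finType) (r : T -> F) (s : U -> F) :
  (forall x y, x \in A -> y \in A -> x + y \in A) ->
  (forall x y, x \in B -> y \in B -> x - y \in B) ->
  {subset B <= A} -> {subset C <= B} ->
  reps A B r -> reps B C s -> reps A C (fun tu : T * U => r tu.1 + s tu.2).
Proof.
move=> addA subB BA CB [rA r_inj r_onto] [sB s_inj s_onto]; split.
- by move=> [t u] /=; apply: addA; last apply: BA.
- move=> [t u] [t' u'] /= h.
  have tt' : t = t'.
    apply: r_inj; have := subB _ _ (CB _ h) (subB _ _ (sB u) (sB u')).
    by rewrite opprD addrACA addrK.
  congr (_, _) => //; apply: s_inj; move: h.
  by rewrite tt' opprD addrACA subrr add0r.
- move=> x /r_onto[t /s_onto[u xtu]]; exists (t, u) => /=.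
  by rewrite opprD addrA.
Qed.

(** The class of [x] is determined by the set of indices [t] with [x - r t] in [B]. The sets that
    occur in this way form a finite type, which indexes the extracted transversal. *)
Lemma reps_subfamily A B (T : finType) (r : T -> F) :
  (forall x y, x \in B -> y \in B -> x - y \in B) -> 0 \in B ->
  (forall x, x \in A -> exists t, x - r t \in B) ->
  exists (U : finType) (s : U -> F), reps A B s.
Proof.
move=> subB B0 r_onto.
pose R (x : F) := [set t | x - r t \in B]%SET.
pose good (E : {set T}) := `[< exists2 x, x \in A & R x = E >].
have /choice[s hs] : forall E : {E : {set T} | good E},
    exists x, x \in A /\ R x = val E.
  by move=> [E /=] /asboolP[x xA <-]; exists x.
have eqR x y : x \in A -> R x = R y -> x - y \in B.
  move=> xA Rxy; have [t xt] := r_onto x xA.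
  have : t \in R y by rewrite -Rxy inE.
  rewrite inE => yt; have := subB _ _ xt yt.
  by rewrite opprB subrKA.
have Rsub x y : x - y \in B -> R x = R y.
  move=> xy; have yx : y - x \in B by rewrite -opprB -sub0r subB.
  apply/setP => t; rewrite !inE; apply/idP/idP => h.
    have -> : y - r t = (x - r t) - (x - y) by rewrite opprB [RHS]addrC subrKA.
    exact: subB.
  have -> : x - r t = (y - r t) - (y - x) by rewrite opprB [RHS]addrC subrKA.
  exact: subB.
exists {E : {set T} | good E}, s; split.
- by move=> t; case: (hs t).
- move=> t u tu; apply: val_inj; case: (hs t) => _ <-; case: (hs u) => _ <-.
  exact: Rsub.
- move=> x xA; have gx : good (R x) by apply/asboolP; exists x.
  exists (exist _ (R x) gx); apply: eqR => //.
  by case: (hs (exist _ (R x) gx)) => _ ->.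
Qed.

End Reps.

(** Multiplication by the [k]-th power of a uniformizer identifies the quotient of the balls of
    index 0 and 1 with that of the balls of index [k] and [k + 1], so each step of the filtration
    contributes a factor [#|T|]. *)
Lemma reps_vball (F : fieldType) (v : F -> int) (T : finType) (r : T -> F) (k : nat) :
  is_valuation v -> reps (vball v 0) (vball v 1) r ->
  exists (U : finType) (s : U -> F),
    reps (vball v 0) (vball v k%:Z) s /\ #|U| = (#|T| ^ k)%N.
Proof.
move=> vv [rA r_inj r_onto]; elim: k => [|k [U [s [hs cU]]]].
  exists unit, (fun=> 0); split; last by rewrite card_unit.
  split=> [_|[] []//|x]; first exact: vball0.
  by exists tt; rewrite subr0.
have [p p0 p1] := uniformizer vv.
have pk0 : p ^+ k != 0 by rewrite expf_neq0.
have vpk : v (p ^+ k) = k%:Z by rewrite valX // p1 mul1r.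
exists (U * T)%type, (fun ut => s ut.1 + p ^+ k * r ut.2); split; last first.
  by rewrite card_prod cU expnSr.
apply: (@reps_tower _ _ (vball v k%:Z) _ U T s (fun t => p ^+ k * r t)) => //.
- by move=> x y; apply: vballD.
- by move=> x y; apply: vballB.
- by apply: vballW.
- by apply: vballW; lia.
have shift y (l : int) : (p ^+ k * y \in vball v (k%:Z + l)) = (y \in vball v l).
  by rewrite -vpk vball_mul_val.
split=> [t|t u|x xk].
- by rewrite -[k%:Z]addr0 shift.
- by rewrite -mulrBr -addn1 PoszD shift; apply: r_inj.
have [|t xt] := r_onto (x / p ^+ k).
  by rewrite -shift addr0 mulrC divfK.
exists t; rewrite -addn1 PoszD.
have -> : x - p ^+ k * r t = p ^+ k * (x / p ^+ k - r t).
  by rewrite mulrBr [p ^+ k * (x / _)]mulrC divfK.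
by rewrite shift.
Qed.

(** * Weak approximation *)

(** Otherwise every [v]-integral element is [w]-integral. Then [x / p ^ v x] and its inverse are
    both [w]-integral for a uniformizer [p] of [v], so [w = w p * v], and the value 1 taken by [w]
    forces [w p = 1]. *)
Lemma valuations_incomparable (F : fieldType) (v w : F -> int) :
  is_valuation v -> is_valuation w -> v <> w ->
  exists x : F, [/\ x != 0, 0 <= v x & w x < 0].
Proof.
move=> vv ww vw; apply: contrapT => nex; apply: vw.
have vw x : x != 0 -> 0 <= v x -> 0 <= w x.
  by move=> x0 vx; rewrite leNgt; apply/negP => wx; apply: nex; exists x.
have [p p0 p1] := uniformizer vv.
have wE x : x != 0 -> w x = w p * v x.
  move=> x0; have px0 := expfz_neq0 (v x) p0.
  have h (s : int) : s = v x -> w (x / p ^ s) = w x - w p * s.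
    by move=> ->; rewrite valM ?invr_neq0 // valV // valXz.
  have vxp : v (x / p ^ v x) = 0.
    by rewrite valM ?invr_neq0 // valV // valXz // p1; lia.
  have z0 : x / p ^ v x != 0 by rewrite mulf_neq0 ?invr_neq0.
  have := vw _ z0; rewrite vxp => /(_ erefl).
  have := vw _ (invr_neq0 z0); rewrite valV // vxp => /(_ erefl).
  by rewrite valV // h //; lia.
have wp : 0 <= w p by apply: vw; rewrite ?p1.
have [q q0 q1] := uniformizer ww.
have wp1 : w p = 1.
  move: (wE q q0) wp; rewrite q1; move: (w p) (v q) => a b ab a0.
  have [|] := leP b 0; last by move=> ?; nia.
  by move=> b0; have := mulr_ge0_le0 a0 b0; rewrite -ab.
by apply/funext => x; have [->|/wE->] := eqVneq x 0; rewrite ?wp1 ?mul1r ?val0.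
Qed.

Section Approximation.
Variables (F : fieldType) (I : finType) (w : I -> F -> int).
Hypothesis w_val : forall i, is_valuation (w i).
Hypothesis w_inj : injective w.

Lemma val_1D_lt0 i (z : F) : z != 0 -> w i z < 0 -> w i (1 + z) = w i z /\ 1 + z != 0.
Proof.
move=> z0 wz; rewrite addrC; apply: valD_lt => //.
by rewrite vballE ?oner_eq0 // val1 //; lia.
Qed.

Lemma val_1D_gt0 i (z : F) : z != 0 -> 0 < w i z -> w i (1 + z) = 0 /\ 1 + z != 0.
Proof.
move=> z0 wz; rewrite -(val1 (w_val i)); apply: valD_lt; rewrite ?oner_eq0 //.
by rewrite vballE // val1 //; lia.
Qed.

Lemma separating_element i (s : seq I) : i \notin s ->
  exists z : F, [/\ z != 0, w i z < 0 & forall j, j \in s -> 0 < w j z].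
Proof.
elim: s => [|j s IH].
  move=> _; have [p p0 p1] := uniformizer (w_val i).
  by exists p^-1; split; rewrite ?invr_neq0 // valV // p1.
rewrite inE negb_or => /andP[ij /IH[z [z0 zi zs]]].
have ne_w : w i <> w j by move=> /w_inj/eqP; exact/negP.
have [x [x0 xj xi]] := valuations_incomparable (w_val j) (w_val i) (nesym ne_w).
have [x' [x'0 x'i x'j]] := valuations_incomparable (w_val i) (w_val j) ne_w.
have [y [y0 yi yj]] : exists y : F, [/\ y != 0, w i y < 0 & 0 < w j y].
  exists (x / x'); split; first by rewrite mulf_neq0 ?invr_neq0.
    by rewrite valM ?invr_neq0 // valV //; lia.
  by rewrite valM ?invr_neq0 // valV //; lia.
(* The [K]-th power of an element of positive valuation at [l] outweighs [y] at [l], whatever the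
   place. *)
pose K := (\max_(l : I) `|w l y|%N).+1.
have K_lt l : - K%:Z < w l y.
  have := @leq_bigmax _ (fun l => `|w l y|%N) l; rewrite /K; lia.
case: (leP 0 (w j z)) => [wjz|wjz].
  exists (z ^+ K * y); split=> [||l].
  - by rewrite mulf_neq0 ?expf_neq0.
  - by rewrite valM ?expf_neq0 // valX //; nia.
  rewrite inE valM ?expf_neq0 // valX // => /predU1P[->|/zs wlz]; first by nia.
  by have := K_lt l; nia.
have zK0 : z ^+ K != 0 by rewrite expf_neq0.
have wiK : w i (z ^+ K) < 0 by rewrite valX // /K; nia.
have wjK : w j (z ^+ K) < 0 by rewrite valX // /K; nia.
have [wi1 ne] := val_1D_lt0 zK0 wiK; have [wj1 _] := val_1D_lt0 zK0 wjK.
(* Here [z] has a pole at [j] as well as at [i]. The quotient is a unit at both, so [y] decides the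
   sign there, while at the places of [s] its valuation is that of [z ^+ K]. *)
exists (z ^+ K / (1 + z ^+ K) * y); split=> [||l].
- by rewrite !mulf_neq0 ?invr_neq0.
- by rewrite !valM ?mulf_neq0 ?invr_neq0 // valV // wi1 subrr add0r.
rewrite inE !valM ?mulf_neq0 ?invr_neq0 // valV // => /predU1P[->|/zs wlz].
  by rewrite wj1 subrr add0r.
have wlK : 0 < w l (z ^+ K) by rewrite valX // /K; nia.
have [-> _] := val_1D_gt0 zK0 wlK.
by rewrite valX //; have := K_lt l; nia.
Qed.

(** With [z] from [separating_element], the element [z ^+ K / (1 + z ^+ K)] is close to 1 where [z]
    has a pole and close to 0 where [z] vanishes. *)
Lemma approximate_idempotent i (N : nat) :
  exists u : F, u - 1 \in vball (w i) N%:Z /\ forall j, j != i -> u \in vball (w j) N%:Z.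
Proof.
have [|z [z0 zi zs]] := @separating_element i (enum (predC1 i)).
  by rewrite mem_enum inE eqxx.
pose K := N.+1.
have zK0 : z ^+ K != 0 by rewrite expf_neq0.
have wiK : w i (z ^+ K) <= - N%:Z by rewrite valX //; nia.
have wiK0 : w i (z ^+ K) < 0 by rewrite valX //; nia.
have [wi1 ne] := val_1D_lt0 zK0 wiK0.
exists (z ^+ K / (1 + z ^+ K)); split.
  have -> : z ^+ K / (1 + z ^+ K) - 1 = - (1 + z ^+ K)^-1.
    by field.
  by rewrite vballN // vballE ?invr_neq0 // valV // wi1 lerNr.
move=> j ji; have wjz : 0 < w j z by apply: zs; rewrite mem_enum.
have wjK : 0 < w j (z ^+ K) by rewrite valX //; nia.
have [wj1 _] := val_1D_gt0 zK0 wjK.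
rewrite vballE ?mulf_neq0 ?invr_neq0 // valM ?invr_neq0 // valV // wj1.
by rewrite valX //; nia.
Qed.

Lemma weak_approximation (y : I -> F) (N : nat) :
  exists x : F, forall i, x - y i \in vball (w i) N%:Z.
Proof.
(* The second summand compensates the poles of the [y j], by which the approximate idempotents are
   multiplied. *)
pose K := (N + \max_(i : I) \max_(j : I) `|w i (y j)|)%N.
have K_le i j : N%:Z <= K%:Z + w i (y j).
  have := @leq_bigmax _ (fun j => `|w i (y j)|%N) j.
  have := @leq_bigmax _ (fun i => \max_(j : I) `|w i (y j)|)%N i.
  by rewrite /K; lia.
have /choice[u hu] := fun i => @approximate_idempotent i K.
exists (\sum_j u j * y j) => i.
rewrite (bigD1 i) //= addrAC; apply: vballD => //.
  rewrite -[X in _ - X]mul1r -mulrBl.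
  apply: (vballW (K_le i i)); apply: vballM => //; first by case: (hu i).
  exact: vball_val.
apply: vball_sum => // j ji; apply: (vballW (K_le i j)).
apply: vballM => //; last exact: vball_val.
by case: (hu j) => _; apply; rewrite eq_sym.
Qed.

(** The Chinese remainder theorem: weak approximation realizes every tuple of local representatives
    by one element. *)
Lemma reps_cap (k : I -> nat) (T : I -> finType) (r : forall i, T i -> F) :
  (forall i, reps (vball (w i) 0) (vball (w i) (k i)%:Z) (r i)) ->
  exists s : {dffun forall i, T i} -> F,
    reps [pred x | [forall i, x \in vball (w i) 0]]
         [pred x | [forall i, x \in vball (w i) (k i)%:Z]] s.
Proof.
move=> hr; pose N := \max_i k i.
have N_ge i : (k i)%:Z <= N%:Z by have := @leq_bigmax _ k i; rewrite /N; lia.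
have /choice[s hs] := fun t : {dffun forall i, T i} =>
  weak_approximation (fun i => r i (t i)) N.
have hsk t i : s t - r i (t i) \in vball (w i) (k i)%:Z by apply: vballW (hs t i).
exists s; split=> [t|t u /forallP tu|x /forallP xA].
- apply/forallP => i; have [rA _ _] := hr i.
  by rewrite -[s t](subrK (r i (t i))) vballD //; apply: vballW (hs t i).
- apply/ffunP => i; have [_ r_inj _] := hr i; apply: r_inj.
  have -> : r i (t i) - r i (u i) =
      (s t - s u) - (s t - r i (t i)) + (s u - r i (u i)).
    by ring.
  by apply: vballD => //; apply: vballB => //; apply: tu.
have h i : {t | x - r i t \in vball (w i) (k i)%:Z}.
  by apply: cid; have [_ _ r_onto] := hr i; apply: r_onto.
pose t : {dffun forall i, T i} := [ffun i => sval (h i)].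
exists t; apply/forallP => i.
have xt : x - r i (t i) \in vball (w i) (k i)%:Z by rewrite ffunE; case: (h i).
have -> : x - s t = (x - r i (t i)) - (s t - r i (t i)) by ring.
exact: vballB.
Qed.

End Approximation.

(** * Degree inequality for extensions of valuations *)

Section Extension.
Variables (L M : fieldType) (iota : {rmorphism L -> M}).
Variables (v : L -> int) (I : finType) (w : I -> M -> int) (e : I -> nat).
Hypothesis v_val : is_valuation v.
Hypothesis w_val : forall i, is_valuation (w i).
Hypothesis w_over_v : forall i c, w i (iota c) = (e i)%:Z * v c.

(** For [v p = 1] one has [w i (iota p) = e i], so [W'] is [iota p * W], and [W / W'] is a vector
    space over the residue field of [v]. *)
Let W : {pred M} := [pred x | [forall i, x \in vball (w i) 0]].
Let W' : {pred M} := [pred x | [forall i, x \in vball (w i) (e i)%:Z]].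

Lemma cap_sub0 : 0 \in W'.
Proof. by apply/forallP => i; apply: vball0. Qed.

Lemma cap_subD x y : x \in W' -> y \in W' -> x + y \in W'.
Proof.
by move=> /forallP xW /forallP yW; apply/forallP => i; apply: vballD.
Qed.

Lemma cap_subB x y : x \in W' -> y \in W' -> x - y \in W'.
Proof.
by move=> /forallP xW /forallP yW; apply/forallP => i; apply: vballB.
Qed.

Lemma cap_sub_sum (J : Type) (r : seq J) (P : pred J) (f : J -> M) :
  (forall j, P j -> f j \in W') -> \sum_(j <- r | P j) f j \in W'.
Proof. by move=> h; elim/big_ind: _ => //; [exact: cap_sub0 | exact: cap_subD]. Qed.

Lemma iota_ball i c k : c \in vball v k -> iota c \in vball (w i) ((e i)%:Z * k).
Proof.
have [->|c0] := eqVneq c 0; first by rewrite rmorph0 => _; apply: vball0.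
by rewrite !vballE ?fmorph_eq0 // w_over_v; nia.
Qed.

Lemma iota_int i c : c \in vball v 0 -> iota c \in vball (w i) 0.
Proof. by move/(iota_ball i); rewrite mulr0. Qed.

Lemma iota_mul_sub c x : c \in vball v 0 -> x \in W' -> iota c * x \in W'.
Proof.
move=> c0 /forallP xW; apply/forallP => i; rewrite -[(e i)%:Z]add0r.
by apply: vballM => //; apply: iota_int.
Qed.

Lemma iota_max_sub c x : c \in vball v 1 -> x \in W -> iota c * x \in W'.
Proof.
move=> c0 /forallP xW; apply/forallP => i; rewrite -[(e i)%:Z]addr0.
by apply: vballM => //; have := iota_ball i c0; rewrite mulr1.
Qed.

(** Linear independence in [W / W'] over the residue field of [v], expressed by integral lifts of
    the coefficients. *)
Definition indep_mod s (b : 'I_s -> M) := forall c : 'I_s -> L,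
  (forall j, c j \in vball v 0) -> \sum_j iota (c j) * b j \in W' ->
  forall j, c j \in vball v 1.

Definition spans_mod s (b : 'I_s -> M) := forall x, x \in W ->
  exists c : 'I_s -> L,
    (forall j, c j \in vball v 0) /\ x - \sum_j iota (c j) * b j \in W'.

(** Dividing a nontrivial relation by a coefficient of least valuation makes all coefficients
    integral and one of them equal to 1, against independence modulo the maximal ideal. *)
Lemma indep_mod_free s (b : 'I_s -> M) (c : 'I_s -> L) : indep_mod b ->
  \sum_j iota (c j) * b j = 0 -> forall j, c j = 0.
Proof.
move=> ib cb0; apply: contrapT => /existsNP[j0 /eqP cj0].
have [j1 /andP[cj1 minj1]] : exists j1, (c j1 != 0) &&
    [forall j, (c j != 0) ==> (v (c j1) <= v (c j))].
  have := @arg_minP _ _ _ j0 (fun j => c j != 0) (fun j => v (c j)) cj0.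
  case=> j1 h1 h2; exists j1; rewrite h1; apply/forallP => j.
  by apply/implyP => /h2.
have cball j : c j / c j1 \in vball v 0.
  have [->|cj] := eqVneq (c j) 0; first by rewrite mul0r vball0.
  rewrite vballE ?mulf_neq0 ?invr_neq0 // valM ?invr_neq0 // valV //.
  by have /forallP/(_ j)/implyP/(_ cj) := minj1; lia.
have /(ib _ cball)/(_ j1) : \sum_j iota (c j / c j1) * b j \in W'.
  rewrite (_ : \sum_j _ = (iota (c j1))^-1 * \sum_j iota (c j) * b j).
    by rewrite cb0 mulr0 cap_sub0.
  rewrite mulr_sumr; apply: eq_bigr => j _.
  by rewrite rmorphM /= fmorphV mulrA [_^-1 * _]mulrC.
by rewrite mulfV // vballE ?oner_eq0 // val1.
Qed.

(* The degree of [M] over [L] enters only as [dimM / dimL], the quotient of two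
   absolute degrees. *)
Variables (dimL dimM : nat).
Hypothesis dimL_gt0 : (0 < dimL)%N.
Hypothesis free_dim : forall s (b : 'I_s -> M),
  (forall c : 'I_s -> L, \sum_j iota (c j) * b j = 0 -> forall j, c j = 0) ->
  (s * dimL <= dimM)%N.

(** Independent families are free over [L], hence of bounded length. One of greatest length spans,
    because adjoining [x] creates a relation in which the coefficient of [x] is invertible. *)
Lemma maximal_indep_mod : exists s (b : 'I_s -> M),
  [/\ forall j, b j \in W, indep_mod b, spans_mod b & (s * dimL <= dimM)%N].
Proof.
pose P s := `[< exists b : 'I_s -> M, (forall j, b j \in W) /\ indep_mod b >].
have indep_dim s (b : 'I_s -> M) : indep_mod b -> (s * dimL <= dimM)%N.
  by move=> ib; apply: (free_dim (b := b)) => c; apply: indep_mod_free.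
have P0 : exists s, P s.
  by exists 0%N; apply/asboolP; exists (fun=> 0); split => [[]|c _ _ []].
have Pmax s : P s -> (s <= dimM)%N.
  by case/asboolP=> b [_ /indep_dim]; apply: leq_trans; rewrite leq_pmulr.
case: (ex_maxnP P0 Pmax) => s /asboolP[b [bW ib]] smax.
exists s, b; split=> //; last exact: (indep_dim _ _ ib).
move=> x xW.
pose b' (j : 'I_s.+1) := if unlift ord0 j is Some k then b k else x.
have b'W j : b' j \in W by rewrite /b'; case: unlift.
have : ~ indep_mod b'.
  move=> ib'; have /smax : P s.+1 by apply/asboolP; exists b'.
  by rewrite ltnn.
move=> /existsNP[c /not_implyP[c0 /not_implyP[cW' /existsNP[j cj]]]].
move: cW'; rewrite big_ord_recl /b' unlift_none.
under eq_bigr do rewrite liftK.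
(* Were this coefficient in the maximal ideal, its term would lie in [W']. The remaining terms would
   then form a relation among the [b k], making every coefficient non-invertible, contrary to
   [cj]. *)
move=> cW'; have cunit : c ord0 \notin vball v 1.
  apply/negP => cmax; apply: cj.
  case: (unliftP ord0 j) => [k|] -> //.
  apply: (ib (fun k => c (lift ord0 k))) => [k'|]; first exact: c0.
  rewrite -[X in X \in _](addKr (iota (c ord0) * x)) addrC.
  by apply: cap_subB => //; apply: iota_max_sub.
have cn0 : c ord0 != 0 by apply: contraNneq cunit => ->; apply: vball0.
have cinv : (c ord0)^-1 \in vball v 0.
  move: cunit; rewrite !vballE ?invr_neq0 // valV //; lia.
exists (fun k => - (c ord0)^-1 * c (lift ord0 k)); split.
  by move=> k; rewrite mulNr vballN // -[0]addr0 vballM.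
rewrite (_ : _ - _ = iota (c ord0)^-1 *
    (iota (c ord0) * x + \sum_(k < s) iota (c (lift ord0 k)) * b k)).
  exact: iota_mul_sub.
rewrite mulrDr mulrA -rmorphM mulVf // rmorph1 mul1r mulr_sumr -sumrN.
congr (_ + _); apply: eq_bigr => k _.
by rewrite mulNr rmorphN mulNr opprK rmorphM mulrA.
Qed.

Section Count.
Variables (T : finType) (r : T -> L).
Hypothesis r_reps : reps (vball v 0) (vball v 1) r.
Variables (s : nat) (b : 'I_s -> M).
Hypotheses (bW : forall j, b j \in W) (b_indep : indep_mod b) (b_spans : spans_mod b).

Lemma reps_indep_mod :
  reps W W' (fun t : {ffun 'I_s -> T} => \sum_j iota (r (t j)) * b j).
Proof.
have [rA r_inj r_onto] := r_reps; split=> [t|t u|x xW].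
- apply/forallP => i; apply: vball_sum => // j _.
  rewrite -[0]addr0; apply: vballM => //; last by have /forallP := bW j; apply.
  exact: iota_int.
- rewrite -sumrB => h; apply/ffunP => j; apply: r_inj.
  apply: (b_indep (c := fun j => r (t j) - r (u j))).
    by move=> k; apply: vballB.
  by under eq_bigr do rewrite rmorphB mulrBl.
have [c [c0 xc]] := b_spans xW.
have /choice[t ht] : forall j, exists t, c j - r t \in vball v 1.
  by move=> j; apply: r_onto.
exists [ffun j => t j].
rewrite -[x](subrK (\sum_j iota (c j) * b j)) -addrA; apply: cap_subD => //.
rewrite -sumrB; apply: cap_sub_sum => j _; rewrite ffunE -mulrBl -rmorphB.
exact: iota_max_sub.
Qed.

(** Two counts of [W / W']: by the Chinese remainder theorem on the left, by coordinates in the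
    basis [b] on the right. *)
Lemma residue_count (Tw : I -> finType) (rw : forall i, Tw i -> M) :
  injective w -> (forall i, reps (vball (w i) 0) (vball (w i) 1) (rw i)) ->
  (\prod_i #|Tw i| ^ e i)%N = (#|T| ^ s)%N.
Proof.
move=> w_inj rw_reps.
have /choice[U0 hU] : forall i, exists U : finType, exists (s : U -> M),
    reps (vball (w i) 0) (vball (w i) (e i)%:Z) s /\ #|U| = (#|Tw i| ^ e i)%N.
  by move=> i; apply: (reps_vball _ (w_val i)) (rw_reps i).
have {}hU i := cid (hU i).
have [f hf] := reps_cap w_val w_inj (fun i => proj1 (svalP (hU i))).
have := reps_card cap_subB hf reps_indep_mod.
rewrite card_dep_ffun card_ffun card_ord => <-.
rewrite foldrE big_image; apply: eq_bigr => i _.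
by rewrite (proj2 (svalP (hU i))).
Qed.

End Count.

(** With a single place, [W] is its valuation ring, and the finite quotient [W / W'] maps onto the
    residue field because [e i] is positive. *)
Lemma finite_residue (T : finType) (r : T -> L) (i : I) : (0 < e i)%N ->
  (forall j, j = i) -> reps (vball v 0) (vball v 1) r ->
  exists (U : finType) (u : U -> M), reps (vball (w i) 0) (vball (w i) 1) u.
Proof.
move=> ei Ii r_reps.
have [s [b [bW ib sb _]]] := maximal_indep_mod.
have [_ _ onto] := reps_indep_mod r_reps bW ib sb.
apply: reps_subfamily (vball0 _ _) _; first by move=> x y; apply: vballB.
move=> x x0; have [|t /forallP/(_ i) ht] := onto x.
  by apply/forallP => j; rewrite (Ii j).
by exists t; apply: vballW ht; lia.
Qed.

End Extension.

(** * Restriction of valuations *)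

Lemma free_dimension (L M : fieldExtType rat) (iota : {rmorphism L -> M}) s
    (b : 'I_s -> M) :
  (forall c : 'I_s -> L, \sum_j iota (c j) * b j = 0 -> forall j, c j = 0) ->
  (s * \dim {:L} <= \dim {:M})%N.
Proof.
move=> b_free.
pose f (c : {ffun 'I_s -> L}) := \sum_j iota (c j) * b j.
have f_lin : linear f.
  move=> a c d; rewrite /f scaler_sumr -big_split; apply: eq_bigr => j _ /=.
  by rewrite !ffunE rmorphD fmorph_numZ mulrDl scalerAl.
pose fM := GRing.isLinear.Build rat {ffun 'I_s -> L} M *:%R f f_lin.
pose fL : {linear {ffun 'I_s -> L} -> M} := HB.pack f fM.
have ker0 : lker (linfun fL) = 0%VS.
  apply/eqP; rewrite -subv0; apply/subvP => c; rewrite memv_ker lfunE /= => /eqP.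
  move/b_free => c0; rewrite memv0; apply/eqP/ffunP => j.
  by rewrite c0 ffunE.
have -> : (s * \dim {:L} = \dim {: {ffun 'I_s -> L}})%N.
  by rewrite !dimvf /= /dim /= card_ord.
rewrite -(@limg_dim_eq _ _ _ (linfun fL) fullv) ?ker0 ?capv0 //.
exact: dimvS (subvf _).
Qed.

(** * Valuation rings and algebraic relations over the rationals *)

Record is_valuation_ring (F : fieldType) (V : {pred F}) : Prop := IsValuationRing {
  valring1 : 1 \in V;
  valringB : forall x y, x \in V -> y \in V -> x - y \in V;
  valringM : forall x y, x \in V -> y \in V -> x * y \in V;
  valring_total : forall x, x != 0 -> x \in V \/ x^-1 \in V }.

Lemma vball_valuation_ring (F : fieldType) (v : F -> int) :
  is_valuation v -> is_valuation_ring (vball v 0).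
Proof.
move=> vv; split; first exact: vball1.
- by move=> x y; apply: vballB.
- by move=> x y; rewrite -[X in _ -> _ -> _ \in vball _ X]addr0; apply: vballM.
- move=> x x0; rewrite !vballE ?invr_neq0 // valV //; lia.
Qed.

Section ValuationRing.
Variables (F : fieldType) (V : {pred F}).
Hypothesis V_ring : is_valuation_ring V.

Lemma valring0 : 0 \in V.
Proof. by rewrite -(subrr 1) valringB ?valring1. Qed.

Lemma valringN x : x \in V -> - x \in V.
Proof. by move=> xV; rewrite -sub0r valringB ?valring0. Qed.

Lemma valringD x y : x \in V -> y \in V -> x + y \in V.
Proof. by move=> xV yV; rewrite -[y]opprK valringB ?valringN. Qed.

Lemma valringX x n : x \in V -> x ^+ n \in V.
Proof.
move=> xV; elim: n => [|n IH]; first exact: valring1 V_ring.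
by rewrite exprS valringM.
Qed.

Lemma valring_nat n : n%:R \in V.
Proof.
elim: n => [|n IH]; first exact: valring0.
by rewrite -addn1 natrD valringD // valring1.
Qed.

(** The maximal ideal, as the set of non-units. Zero is listed separately because [0^-1 = 0] belongs
    to [V]. *)
Definition valring_max : {pred F} :=
  [pred x | (x \in V) && ((x == 0) || (x^-1 \notin V))].

Lemma valring_maxD x y : x \in valring_max -> y \in valring_max ->
  x + y \in valring_max.
Proof.
wlog : x y / (y == 0) || (x / y \in V).
  move=> wl; have [->|y0] := eqVneq y 0; first by rewrite addr0.
  have [->|x0] := eqVneq x 0; first by rewrite add0r.
  have [] := valring_total V_ring (mulf_neq0 x0 (invr_neq0 y0)).
    by move=> h; apply: wl; rewrite h orbT.
  move=> h xm ym; rewrite addrC; apply: wl => //.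
  by rewrite -invf_div h orbT.
have [->|y0 /= xy] := eqVneq y 0; first by rewrite addr0.
rewrite !inE (negPf y0) /= => /andP[xV _] /andP[yV yV'].
rewrite valringD //=; have [//|xy0 /=] := eqVneq (x + y) 0.
apply: contra yV' => h.
rewrite (_ : y^-1 = (x + y)^-1 * (x / y + 1)).
  by rewrite valringM // valringD // valring1.
by field; rewrite y0 xy0.
Qed.

Lemma valring_max_sum (I : Type) (r : seq I) (P : pred I) (f : I -> F) :
  (forall i, P i -> f i \in valring_max) -> \sum_(i <- r | P i) f i \in valring_max.
Proof.
move=> h; elim/big_ind: _ => //; last exact: valring_maxD.
by rewrite inE valring0 eqxx.
Qed.

Lemma valring_seq_max (I : eqType) (s : seq I) (t : I -> F) :
  (exists2 i, i \in s & t i != 0) ->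
  exists i, [/\ i \in s, t i != 0 & forall j, j \in s -> t j / t i \in V].
Proof.
elim: s => [|k s IH] [i0]; first by rewrite in_nil.
case: (pselect (exists2 i, i \in s & t i != 0)) => [/IH[m [ms m0 mmax]] _ _|nex];
  last first.
  rewrite inE => /predU1P[->|si] ti0; last by case: nex; exists i0.
  exists k; split=> //; first exact: mem_head.
  move=> j; rewrite inE => /predU1P[->|js]; first by rewrite mulfV // valring1.
  have [->|tj] := eqVneq (t j) 0; first by rewrite mul0r valring0.
  by case: nex; exists j.
have [|kmV] := boolP (t k / t m \in V).
  exists m; split=> //; first by rewrite inE ms orbT.
  by move=> j; rewrite inE => /predU1P[->//|/mmax].
have k0 : t k != 0 by apply: contraNneq kmV => ->; rewrite mul0r valring0.
exists k; split=> //; first exact: mem_head.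
move=> j; rewrite inE => /predU1P[->|js]; first by rewrite mulfV // valring1.
have [|] := valring_total V_ring (mulf_neq0 k0 (invr_neq0 m0)).
  by move=> h; rewrite h in kmV.
rewrite invf_div => h.
rewrite (_ : t j / t k = (t j / t m) * (t m / t k)); first by rewrite valringM // mmax.
by field; rewrite k0 m0.
Qed.

(** In a vanishing sum the largest size is attained twice: otherwise, dividing by the dominant term
    [t i], the other terms lie in the maximal ideal and add up to [-1]. *)
Lemma valring_cancel (I : finType) (t : I -> F) :
  \sum_i t i = 0 -> (exists i, t i != 0) ->
  exists i j, [/\ i != j, t i != 0, t j != 0, t i / t j \in V & t j / t i \in V].
Proof.
move=> t0 [i0 ti0].
have [|i [_ ti imax]] := @valring_seq_max _ (enum I) t.
  by exists i0; rewrite ?mem_enum.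
have {}imax j : t j / t i \in V by apply: imax; rewrite mem_enum.
apply: contrapT => nex.
have : \sum_(j | j != i) t j / t i \in valring_max.
  apply: valring_max_sum => j ji; rewrite inE imax /=.
  have [->|tj] := eqVneq (t j) 0; first by rewrite mul0r eqxx.
  rewrite mulf_eq0 invr_eq0 (negPf tj) (negPf ti) /= invf_div.
  by apply/negP => h; apply: nex; exists i, j; split; rewrite // eq_sym.
rewrite -mulr_suml (_ : \sum_(j | j != i) t j = - t i); last first.
  by apply/eqP; rewrite -addr_eq0 addrC; move: t0; rewrite (bigD1 i) //= => ->.
rewrite mulNr mulfV // inE oppr_eq0 oner_eq0 invrN invr1 /=.
by rewrite valringN ?valring1.
Qed.

End ValuationRing.

Lemma rational_relation (M : fieldExtType rat) (x : M) :
  exists c : 'I_(\dim {:M}).+1 -> rat,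
    \sum_i (c i)%:A * x ^+ i = 0 /\ exists i, c i != 0.
Proof.
set n := \dim {:M}; apply: contrapT => nex.
have : (n.+1 * \dim {:rat^o} <= n)%N.
  apply: (@free_dimension rat^o M (in_alg M) _ (fun i : 'I_n.+1 => x ^+ i)).
  move=> c cx; apply: contrapT => /existsNP[i ci]; apply: nex.
  by exists c; split=> //; exists i; apply/eqP.
by rewrite dimvf /= /dim /= muln1 ltnn.
Qed.

(** Two terms [c i * x ^ i] and [c j * x ^ j] of a rational relation of [x] have the same size by
    [valring_cancel]. Their quotient shows that [x ^ (j - i)] is rational up to a unit of [V]; the
    bound on the exponent is that of the relation. *)
Lemma power_rational_unit (M : fieldExtType rat) (V : {pred M}) (x : M) :
  is_valuation_ring V -> x != 0 ->
  exists (k : nat) (r : rat),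
    [/\ (0 < k <= \dim {:M})%N, r != 0, x ^+ k / r%:A \in V & r%:A / x ^+ k \in V].
Proof.
move=> VV x0; have [c [cx [i ci]]] := rational_relation x.
have alg0 (r : rat) : (r%:A == 0 :> M) = (r == 0) by rewrite -in_algE fmorph_eq0.
have [|{ci}i [j [ij]]] := valring_cancel VV cx.
  by exists i; rewrite mulf_neq0 ?alg0 ?expf_neq0.
wlog : i j ij / (i < j)%N.
  move=> wl; case: (ltngtP i j) => [|ji ti tj iV jV|/val_inj/eqP].
  - exact: wl.
  - by apply: (wl j i); rewrite // eq_sym.
  by rewrite (negPf ij).
move=> ltij; rewrite !mulf_eq0 !alg0 !negb_or => /andP[ci xi] /andP[cj xj] h1 h2.
exists (j - i)%N, (c i / c j); rewrite subn_gt0 ltij mulf_neq0 ?invr_neq0 //.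
have cn0 k : c k != 0 -> (c k)%:A != 0 :> M by rewrite alg0.
have E1 : x ^+ (j - i) / (c i / c j)%:A = (c j)%:A * x ^+ j / ((c i)%:A * x ^+ i).
  rewrite -[in RHS](subnKC (ltnW ltij)) exprD -!in_algE fmorph_div.
  by field; rewrite /= !scaler_eq0 !oner_eq0 !orbF ci cj xi.
have E2 : (c i / c j)%:A / x ^+ (j - i) = (c i)%:A * x ^+ i / ((c j)%:A * x ^+ j).
  by rewrite -invf_div E1 invf_div.
by rewrite E1 E2; split=> //; rewrite -ltnS (leq_ltn_trans (leq_subr i j)).
Qed.

(** The values form a nonzero subgroup of the integers. Its least positive element [e] divides every
    value, since a remainder is again a value, taken at [x] divided by a power of [g]. *)
Lemma normalize_valuation (F : fieldType) (kappa : F -> int) :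
  kappa 0 = 0 ->
  (forall x y, x != 0 -> y != 0 -> kappa (x * y) = kappa x + kappa y) ->
  (forall x y, x != 0 -> y != 0 -> x + y != 0 ->
     Num.min (kappa x) (kappa y) <= kappa (x + y)) ->
  (exists x, kappa x != 0) ->
  exists (e : nat) (v : F -> int),
    [/\ (0 < e)%N, is_valuation v & forall x, kappa x = e%:Z * v x].
Proof.
move=> k0 kM kD [x0 kx0].
have x00 : x0 != 0 by apply: contraNneq kx0 => ->; rewrite k0.
have k1 : kappa 1 = 0.
  by have := kM 1 1 (oner_neq0 F) (oner_neq0 F); rewrite mulr1; move: (kappa 1) => a; lia.
have kV x : x != 0 -> kappa x^-1 = - kappa x.
  by move=> xn0; have := kM _ _ xn0 (invr_neq0 xn0); rewrite mulfV // k1; lia.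
have kX x n : x != 0 -> kappa (x ^+ n) = kappa x * n%:Z.
  move=> xn0; elim: n => [|n IH]; first by rewrite k1 mulr0.
  by rewrite exprS kM ?expf_neq0 // IH -addn1 PoszD mulrDr mulr1 addrC.
have kXz x (n : int) : x != 0 -> kappa (x ^ n) = kappa x * n.
  by move=> xn0; case: n => n; rewrite ?kV ?expf_neq0 // kX // NegzE mulrN.
pose P n := `[< (0 < n)%N /\ exists2 x, x != 0 & kappa x = n%:Z >].
have exP : exists n, P n.
  exists `|kappa x0|%N; apply/asboolP; split; first lia.
  have [le0|lt0] := leP 0 (kappa x0); first by exists x0; rewrite // gez0_abs.
  by exists x0^-1; rewrite ?invr_neq0 // kV // ltz0_abs.
case: (ex_minnP exP) => e /asboolP[e0 [g g0 kg]] emin.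
have dvd x : (e %| kappa x)%Z.
  have [->|xn0] := eqVneq x 0; first by rewrite k0 dvdz0.
  rewrite -[X in (_ %| X)%Z]/(kappa x); apply/dvdz_mod0P.
  have rE : (kappa x %% e)%Z = kappa (x / g ^ (kappa x %/ e)%Z).
    rewrite kM ?invr_neq0 ?expfz_neq0 // kV ?expfz_neq0 // kXz // kg.
    by have := divz_eq (kappa x) e; set a := (_ %/ _)%Z; set b := (_ %% _)%Z; lia.
  have e0' : (e : int) != 0 by rewrite eqz_nat -lt0n.
  have r0 : 0 <= (kappa x %% e)%Z by rewrite modz_ge0.
  have re : (kappa x %% e)%Z < e%:Z by rewrite ltz_pmod // ltz_nat.
  apply/eqP; rewrite eq_le r0 andbT leNgt; apply/negP => rgt0.
  have : P `|(kappa x %% e)%Z|%N.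
    apply/asboolP; split; first by lia.
    exists (x / g ^ (kappa x %/ e)%Z); first by rewrite mulf_neq0 ?invr_neq0 ?expfz_neq0.
    by rewrite -rE gez0_abs.
  by move/emin; lia.
have eZ0 : (0 : int) < e%:Z by rewrite ltz_nat.
have kE x : kappa x = e%:Z * (kappa x %/ e)%Z by rewrite mulrC divzK.
exists e, (fun x => (kappa x %/ e)%Z); split=> //; split.
- by rewrite k0 div0z.
- move=> x y xn0 yn0; apply: (mulfI (lt0r_neq0 eZ0)).
  by rewrite mulrDr -!kE kM.
- move=> x y xn0 yn0 xy0; rewrite -(ler_pM2l eZ0).
  have minM (a b : int) : e%:Z * Num.min a b <= Num.min (e%:Z * a) (e%:Z * b).
    by rewrite le_min !ler_pM2l // !ge_min !lexx orbT.
  by apply: le_trans (minM _ _) _; rewrite -!kE kD.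
- exists g => //; apply: (mulfI (lt0r_neq0 eZ0)).
  by rewrite -kE kg mulr1.
Qed.

(** A positive power of a uniformizer is a unit times a rational number, by
    [power_rational_unit]. *)
Lemma valuation_nontrivial_rat (M : fieldExtType rat) (w : M -> int) :
  is_valuation w -> exists2 r : rat, r != 0 & 0 < w r%:A.
Proof.
move=> ww; have [p p0 p1] := uniformizer ww.
have [k [r [/andP[k0 _] r0 h1 h2]]] :=
  power_rational_unit (vball_valuation_ring ww) p0.
have rA0 : r%:A != 0 :> M by rewrite -in_algE fmorph_eq0.
exists r => //; move: h2; rewrite vballE ?mulf_neq0 ?invr_neq0 ?expf_neq0 //.
by rewrite valM ?invr_neq0 ?expf_neq0 // valV // valX // p1; lia.
Qed.

Lemma restrict_valuation (L M : fieldExtType rat) (iota : {rmorphism L -> M})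
    (w : M -> int) : is_valuation w ->
  exists (e : nat) (v : L -> int),
    [/\ (0 < e)%N, is_valuation v & forall x, w (iota x) = e%:Z * v x].
Proof.
move=> ww; apply: normalize_valuation.
- by rewrite rmorph0 val0.
- by move=> x y x0 y0; rewrite rmorphM valM ?fmorph_eq0.
- move=> x y x0 y0 xy0; rewrite rmorphD.
  by have [_ _ + _] := ww; apply; rewrite -?rmorphD ?fmorph_eq0.
have [r r0 wr] := valuation_nontrivial_rat ww.
by exists r%:A; rewrite fmorph_numZ rmorph1 lt0r_neq0.
Qed.

(** * Places over a rational prime *)

Lemma bezout_coprime (p m : nat) : prime p -> ~~ (p %| m)%N ->
  exists a b : nat, (a * m = b * p + 1)%N.
Proof.
move=> pp pm; have m0 : (0 < m)%N by case: m pm; rewrite ?dvdn0.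
have cop : coprime m p by rewrite coprime_sym prime_coprime.
case: (egcdnP p m0) => a b E _; exists a, b.
by rewrite E (eqP cop).
Qed.

Section ValuationNat.
Variables (F : fieldType) (w : F -> int) (p : nat).
Hypotheses (w_val : is_valuation w) (p_prime : prime p) (wp : 0 < w p%:R).

Lemma val_natp_neq0 : p%:R != 0 :> F.
Proof. by apply: contraTneq wp => ->; rewrite val0. Qed.

(** If [m] had positive valuation, so would [1 = a * m - b * p]. *)
Lemma val_coprime_nat m : ~~ (p %| m)%N -> m%:R != 0 :> F /\ w m%:R = 0.
Proof.
move=> pm; have [a [b E]] := bezout_coprime p_prime pm.
have pball : p%:R \in vball w 1 by rewrite vballE ?val_natp_neq0 //; lia.
have nm : m%:R \notin vball w 1.
  apply/negP => mball; have : 1 \in vball w 1.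
    have -> : 1 = a%:R * m%:R - b%:R * p%:R :> F.
      by rewrite -!natrM E natrD addrC addKr.
    apply: vballB => //; rewrite -[X in vball w X]add0r;
    by apply: vballM => //; apply: vball_nat.
  by rewrite vballE ?oner_eq0 // val1.
have m0 : m%:R != 0 :> F by apply: contraNneq nm => ->; apply: vball0.
split=> //; have := vball_nat w_val m; move: nm.
by rewrite !vballE //; lia.
Qed.

Lemma val_nat m : (0 < m)%N -> m%:R != 0 :> F /\ w m%:R = w p%:R * (logn p m)%:Z.
Proof.
move=> m0; have [m' cop E] := pfactor_coprime p_prime m0.
have [|m'0 wm'] := @val_coprime_nat m'; first by rewrite -prime_coprime.
rewrite {1 2}E natrM natrX mulf_neq0 ?expf_neq0 ?val_natp_neq0 //; split=> //.
by rewrite valM ?expf_neq0 ?val_natp_neq0 // wm' add0r valX.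
Qed.

Lemma val_int (m : int) : m != 0 ->
  m%:~R != 0 :> F /\ w m%:~R = w p%:R * (logn p `|m|)%:Z.
Proof.
move=> m0; have [|m0' <-] := @val_nat `|m|; first by rewrite absz_gt0.
have [h|h] := leP 0 m; first by rewrite -{1 2}(gez0_abs h).
have -> : m%:~R = - (`|m|%N)%:R :> F.
  transitivity ((- (`|m|%N : int))%:~R : F); last by rewrite rmorphN.
  by congr (_%:~R); lia.
by rewrite oppr_eq0 valN.
Qed.

End ValuationNat.

Definition padic (p : nat) (r : rat) : int :=
  (logn p `|numq r|)%:Z - (logn p `|denq r|)%:Z.

Lemma padic0 p : padic p 0 = 0.
Proof. by rewrite /padic (_ : numq 0 = 0) // (_ : denq 0 = 1) // absz0 absz1 logn0 logn1. Qed.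

Lemma val_rat (M : fieldExtType rat) (w : M -> int) (p : nat) (r : rat) :
  is_valuation w -> prime p -> 0 < w p%:R -> w r%:A = w p%:R * padic p r.
Proof.
move=> ww pp wp; have [->|r0] := eqVneq r 0.
  by rewrite scale0r val0 // padic0 mulr0.
have [|n0 wn] := val_int ww pp wp (m := numq r); first by rewrite numq_eq0.
have [d0 wd] := val_int ww pp wp (denq_neq0 r).
rewrite -in_algE -[in LHS](divq_num_den r) fmorph_div !rmorph_int.
by rewrite valM ?invr_neq0 // valV // wn wd /padic mulrBr.
Qed.

Lemma padicp p : prime p -> padic p p%:R = 1.
Proof.
move=> pp; rewrite /padic -[p%:R]/(p%:Z%:~R) numq_int denq_int /=.
by rewrite logn1 logn_prime // eqxx.
Qed.

(** The restriction of [w] to the rationals is [w p] times [padic p], so the axioms for [padic p]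
    are those of [w] divided by a positive integer. *)
Lemma padic_valuation (M : fieldExtType rat) (w : M -> int) p :
  is_valuation w -> prime p -> 0 < w p%:R -> is_valuation (padic p).
Proof.
move=> ww pp wp; have h r := val_rat r ww pp wp.
have alg0 (r : rat) : (r%:A == 0 :> M) = (r == 0) by rewrite -in_algE fmorph_eq0.
have wp0 := lt0r_neq0 wp.
split.
- exact: padic0.
- move=> x y x0 y0; apply: (mulfI wp0); rewrite [in RHS]mulrDr -!h -valM ?alg0 //.
  by rewrite -!in_algE rmorphM.
- move=> x y x0 y0 xy0; rewrite -(ler_pM2l wp).
  have minM (a b : int) : w p%:R * Num.min a b <= Num.min (w p%:R * a) (w p%:R * b).
    by rewrite le_min !ler_pM2l // !ge_min !lexx orbT.
  apply: le_trans (minM _ _) _; rewrite -!h scalerDl.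
  by have [_ _ + _] := ww; apply; rewrite -?scalerDl ?alg0.
- by exists p%:R; rewrite ?padicp // pnatr_eq0 -lt0n prime_gt0.
Qed.

Lemma padic_residue p : prime p -> is_valuation (padic p) ->
  reps (vball (padic p) 0) (vball (padic p) 1) (fun t : 'I_p => (t : nat)%:R : rat).
Proof.
move=> pp pv; have p1 := padicp pp.
have pgt0 : 0 < padic p p%:R by rewrite p1.
split=> [t|t u|x xint]; first exact: vball_nat.
- wlog : t u / (t <= u)%N.
    move=> wl tu; have [tu'|/ltnW ut] := leqP t u; first exact: wl.
    by apply/esym/wl => //; rewrite -opprB vballN.
  move=> tu; rewrite -opprB vballN // -natrB // => h.
  apply/val_inj/eqP => /=; rewrite eqn_leq tu /= -subn_eq0; apply: contraTT h.
  rewrite -lt0n => ut; have [|n0 vn] := val_coprime_nat pv pp pgt0 (m := (u - t)%N).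
    by rewrite gtnNdvd // (leq_ltn_trans (leq_subr _ _)).
  by rewrite vballE // vn.
have [d0 vd] := val_int pv pp pgt0 (denq_neq0 x).
have dp : ~~ (p %| `|denq x|)%N.
  have [x0|x0] := eqVneq x 0.
    by rewrite x0 (_ : denq 0 = 1) // dvdn1; case: (p) pp => [|[]].
  apply/negP => pd; move: xint; rewrite vballE // /padic.
  have : (0 < logn p `|denq x|)%N by rewrite logn_gt0 mem_primes pp pd absz_gt0 denq_neq0.
  have pn : ~~ (p %| `|numq x|)%N.
    apply/negP => pn; have := coprime_num_den x; rewrite /coprime => /eqP g1.
    have : (p %| 1)%N by rewrite -g1 dvdn_gcd pn pd.
    by rewrite dvdn1 => /eqP p1'; rewrite p1' in pp.
  have -> : logn p `|numq x| = 0%N.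
    by apply/eqP; rewrite -leqn0 leqNgt logn_gt0 mem_primes (negPf pn) !andbF.
  by lia.
(* Modulo [p], [a] inverts the denominator, so [x] is congruent to [numq x * a], whose remainder [t]
   is the representative. *)
have [a [b E]] := bezout_coprime pp dp.
pose t := ((numq x * a%:Z) %% p%:Z)%Z.
have p0 : (p : int) != 0 by rewrite eqz_nat -lt0n prime_gt0.
have t0 : 0 <= t by rewrite modz_ge0.
have tp : t < p%:Z by rewrite ltz_pmod // ltz_nat prime_gt0.
have tp' : (`|t| < p)%N by rewrite -ltz_nat gez0_abs.
exists (Ordinal tp') => /=.
have -> : (`|t|%N)%:R = (t%:~R : rat) by rewrite -[in RHS](gez0_abs t0).
have -> : x - t%:~R = p%:R * ((numq x * a%:Z %/ p%:Z)%Z%:~R - b%:R * x).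
  have : (numq x * a%:Z)%:~R = ((numq x * a%:Z %/ p%:Z)%Z * p%:Z + t)%:~R :> rat.
    by rewrite -divz_eq.
  have : (a * `|denq x|)%:R = (b * p + 1)%:R :> rat by rewrite E.
  rewrite natrM natrD natrM rmorphD !rmorphM /=.
  have -> : (`|denq x|%N)%:R = (denq x)%:~R :> rat by rewrite -[in RHS]absz_denq.
  have nE : (numq x)%:~R = x * (denq x)%:~R :> rat by rewrite numqE.
  rewrite nE => h1 h2.
  have : x * (a%:R * (denq x)%:~R) = x * (b%:R * p%:R + 1) by rewrite h1.
  rewrite mulrBr; move: h2; rewrite -[a%:~R]/(a%:R) -[p%:~R]/(p%:R).
  by move=> h2 h3; lra.
rewrite -[X in vball _ X]addr0 -{1}p1 vballM ?vball_val //.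
apply: vballB => //; last by rewrite -[0]addr0 vballM // vball_nat.
by case: (_ %/ _)%Z => n; rewrite ?NegzE ?rmorphN ?vballN ?vball_nat.
Qed.

(** * Existence of a place above a prime *)

Section Existence.
Variables (M : fieldExtType rat) (p : nat).
Hypothesis p_prime : prime p.
Let P : M := p%:R.

Lemma nat_alg_neq0 m : (0 < m)%N -> m%:R != 0 :> M.
Proof.
move=> m0; rewrite -(rmorph_nat (in_alg M)) fmorph_eq0 pnatr_eq0 -lt0n //.
Qed.

Let P0 : P != 0.
Proof. by apply: nat_alg_neq0; rewrite prime_gt0. Qed.

(** The third clause says that a nonempty [A] contains 1. It lets the empty set through, as Zorn's
    lemma also asks for the union of the empty chain. A maximal [A] is nonempty, being otherwise
    strictly contained in the image of the integers. *)
Definition subring_without_pV (A : set M) : Prop :=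
  [/\ (forall x y, A x -> A y -> A (x - y)), (forall x y, A x -> A y -> A (x * y)),
      (forall x, A x -> A 1) & ~ A P^-1].

Lemma maximal_subring_without_pV :
  exists A : set M, [/\ subring_without_pV A, A 1 &
    forall B, A `<` B -> ~ subring_without_pV B].
Proof.
have [F Fsub Ftot|A [AP Amax]] := @Zorn_bigcup M subring_without_pV.
  have dir x y X Y : F X -> F Y -> X x -> Y y -> exists Z, [/\ F Z, Z x & Z y].
    move=> FX FY Xx Yy; have [XY|YX] := Ftot _ _ FX FY.
      by exists Y; split=> //; apply: XY.
    by exists X; split=> //; apply: YX.
  split.
  - move=> x y [X FX Xx] [Y FY Yy]; have [Z [FZ Zx Zy]] := dir _ _ _ _ FX FY Xx Yy.
    by exists Z => //; have [h _ _ _] := Fsub _ FZ; apply: h.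
  - move=> x y [X FX Xx] [Y FY Yy]; have [Z [FZ Zx Zy]] := dir _ _ _ _ FX FY Xx Yy.
    by exists Z => //; have [_ h _ _] := Fsub _ FZ; apply: h.
  - by move=> x [X FX Xx]; exists X => //; have [_ _ h _] := Fsub _ FX; apply: h Xx.
  - by move=> [X FX Xx]; have [_ _ _] := Fsub _ FX.
exists A; split=> //; apply: contrapT => A1.
pose B : set M := [set x | exists n : int, x = n%:~R].
apply: (Amax B).
  split; first by move=> x Ax; have [_ _ /(_ _ Ax) /A1] := AP.
  move=> BA; have /BA Ax : B 0 by exists 0.
  by have [_ _ /(_ _ Ax) /A1] := AP.
split.
- by move=> x y [m ->] [n ->]; exists (m - n); rewrite rmorphB.
- by move=> x y [m ->] [n ->]; exists (m * n); rewrite rmorphM.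
- by move=> x _; exists 1.
move=> [n En]; have : p%:Z * n = 1.
  apply: (@intr_inj rat); apply: (fmorph_inj (in_alg M)).
  by rewrite rmorph1 !rmorph_int intrM -En /= mulfV.
by have := prime_gt1 p_prime; case: (leP n 0) => *; nia.
Qed.

Section Maximal.
Variable A : set M.
Hypotheses (A_ok : subring_without_pV A) (A1 : A 1).
Hypothesis A_max : forall B, A `<` B -> ~ subring_without_pV B.

Let AB x y : A x -> A y -> A (x - y). Proof. by case: A_ok => + _ _ _; apply. Qed.
Let AM x y : A x -> A y -> A (x * y). Proof. by case: A_ok => _ + _ _; apply. Qed.
Let ApV : ~ A P^-1. Proof. by case: A_ok. Qed.
Let A0 : A 0. Proof. by rewrite -(subrr 1); apply: AB. Qed.
Let AN x : A x -> A (- x). Proof. by move=> Ax; rewrite -sub0r; apply: AB. Qed.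
Let AD x y : A x -> A y -> A (x + y).
Proof. by move=> Ax Ay; rewrite -[y]opprK; apply: AB => //; apply: AN. Qed.
Let AX x n : A x -> A (x ^+ n).
Proof. by move=> Ax; elim: n => [|n IH]; rewrite ?expr0 ?exprS //; apply: AM. Qed.
Let Asum (I : Type) (r : seq I) (Q : pred I) (f : I -> M) :
  (forall i, Q i -> A (f i)) -> A (\sum_(i <- r | Q i) f i).
Proof. by move=> h; elim/big_ind: _ => //; exact: AD. Qed.
Let AP : A P.
Proof. by rewrite /P; elim: (p) => [|n IH] //; rewrite -addn1 natrD; apply: AD. Qed.

Let coefs_in (q : {poly M}) := forall i, A q`_i.

Lemma maximal_adjoin z : ~ A z -> exists q : {poly M}, coefs_in q /\ q.[z] = P^-1.
Proof.
move=> Az; pose B : set M := [set x | exists q : {poly M}, coefs_in q /\ q.[z] = x].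
have constB c : A c -> B c.
  move=> Ac; exists c%:P; split; last by rewrite hornerC.
  by move=> i; rewrite coefC; case: ifP.
apply: contrapT => nex; apply: (A_max (B := B)).
  split=> // BA; apply: Az; apply: BA; exists 'X; rewrite hornerX; split=> // i.
  by rewrite coefX; case: (_ == _).
split=> //.
- move=> x y [q [qA <-]] [q' [qA' <-]]; exists (q - q'); rewrite hornerD hornerN.
  by split=> // i; rewrite coefB; apply: AB.
- move=> x y [q [qA <-]] [q' [qA' <-]]; exists (q * q'); rewrite hornerM.
  by split=> // i; rewrite coefM; apply: Asum => j _; apply: AM.
- by move=> x _; apply: constB.
Qed.

(** [P] lies in the Jacobson radical of [A]. For [y = 1 - P * a] with inverse outside [A],
    maximality makes [P^-1] a polynomial in [y^-1] over [A]; multiplied by a high power of [y] it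
    falls into [A]. That power is [1 - P * b] with [b] in [A], so [P^-1] itself would be in [A]. *)
Lemma maximal_jacobson a : A a -> 1 - P * a != 0 /\ A (1 - P * a)^-1.
Proof.
move=> Aa; set y := 1 - P * a.
have y0 : y != 0.
  apply/eqP => /eqP; rewrite subr_eq0 => /eqP E.
  by apply: ApV; rewrite -[P^-1]mulr1 E mulKf.
split=> //; apply: contrapT => /maximal_adjoin[q [qA qy]].
have Ay : A y by apply: AB => //; apply: AM => //; apply: AP.
have [b [Ab yE]] : exists b, A b /\ y ^+ size q = 1 - P * b.
  elim: (size q) => [|n [b [Ab IH]]]; first by exists 0; rewrite mulr0 subr0.
  exists (b + a - P * (a * b)); split.
    by apply: AB; [apply: AD | apply: AM => //; apply: AM].
  by rewrite exprS IH /y; ring.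
apply: ApV; rewrite (_ : P^-1 = y ^+ size q / P + b); last first.
  by rewrite yE mulrBl mul1r [P * b]mulrC mulfK // subrK.
apply: AD => //; rewrite -qy horner_coef mulr_sumr; apply: Asum => i _.
rewrite mulrCA; apply: AM => //.
by rewrite exprVn -expfB //; apply: AX.
Qed.

(** Says that 1 lies in the ideal generated by [P] in [A[z]], with control of the degree in [z]. *)
Definition unit_relation (z : M) (r : nat) := exists q : {poly M},
  [/\ (size q <= r.+1)%N, (forall i, exists2 a, A a & q`_i = P * a) & q.[z] = 1].

(* Chevalley's degree reduction: the shorter of the two relations eliminates the
   leading term of the longer one. *)
Lemma no_two_unit_relations n (z : M) r s : z != 0 -> (r + s <= n)%N ->
  unit_relation z r -> unit_relation z^-1 s -> False.
Proof.
elim: n z r s => [|n IH] z r s z0.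
  rewrite leqn0 addn_eq0 => /andP[/eqP-> _] [q [sq qA q1]] _.
  have [a Aa qa] := qA 0%N.
  move: q1; rewrite (size1_polyC sq) hornerC qa => E.
  by apply: ApV; rewrite -[P^-1]mulr1 -E mulKf.
wlog : z r s z0 / (s <= r)%N.
  move=> wl rs hr hs; have [sr|/ltnW rs'] := leqP s r; first exact: (wl z r s).
  by apply: (wl z^-1 s r); rewrite ?invr_neq0 ?invrK // addnC.
move=> sr rs [q [sq qA q1]] [h [sh hA h1]].
have [r0|r0] := posnP r.
  apply: (IH z 0%N 0%N z0 (leq0n n)); first by exists q; rewrite -r0.
  by exists h; split=> //; move: sr sh; rewrite r0 leqn0 => /eqP->.
case: r r0 sr rs sq => // r _ sr rs sq.
have [a0 Aa0 h0] := hA 0%N; have [u0 Au] := maximal_jacobson Aa0.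
(* The relation for [z^-1] times [z ^ r.+1] reads [(1 - P * a0) * z ^ r.+1 = sum_(i >= 1) h_i * z ^
   (r.+1 - i)]. Dividing by the unit [1 - P * a0] expresses [z ^ r.+1] through lower powers. *)
pose k : {poly M} := \sum_(1 <= i < s.+1) ((1 - P * a0)^-1 * h`_i)%:P * 'X^(r.+1 - i).
have zk : k.[z] = z ^+ r.+1.
  rewrite /k horner_sum; apply: (mulfI u0).
  have -> : (1 - P * a0) * z ^+ r.+1 = (h.[z^-1] - h`_0) * z ^+ r.+1 by rewrite h1 h0.
  rewrite (horner_coef_wide _ sh) -(big_mkord predT (fun i => h`_i * z^-1 ^+ i)).
  rewrite [in RHS]big_ltn //= expr0 mulr1 [h`_0 + _]addrC addrK mulr_sumr mulr_suml.
  rewrite big_nat [RHS]big_nat; apply: eq_bigr => i /andP[i0 si].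
  rewrite hornerM hornerC hornerXn !mulrA mulfV // mul1r -mulrA; congr (_ * _).
  rewrite -{2}(subnK (leq_trans (ltnSE si) sr)) exprD mulrCA exprVn.
  by rewrite mulVf ?expf_neq0 // mulr1.
have kA i : exists2 a, A a & k`_i = P * a.
  rewrite /k coef_sum; elim/big_rec: _ => [|j x _ [a Aa ->]].
    by exists 0; rewrite ?mulr0.
  have [b Ab hb] := hA j; rewrite coefCM coefXn hb.
  exists ((1 - P * a0)^-1 * b * (i == (r.+1 - j)%N)%:R + a); last by ring.
  by apply: AD => //; apply: AM; [apply: AM | case: (_ == _)].
have sk : (size k <= r.+1)%N.
  rewrite /k; apply/leq_sizeP => i ri; rewrite coef_sum big_nat big1 // => j /andP[j0 _].
  by rewrite coefCM coefXn; case: eqP => [E|]; rewrite ?mulr0 //; lia.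
apply: (IH z r s z0 rs); last by exists h.
exists (q - (q`_r.+1)%:P * 'X^(r.+1) + (q`_r.+1)%:P * k); split.
- apply/leq_sizeP => i ri; rewrite coefD coefB !coefCM coefXn.
  move/leq_sizeP: sk => /(_ _ ri) ->; rewrite mulr0 addr0.
  have [->|ne] := eqVneq i r.+1; first by rewrite mulr1 subrr.
  have ri2 : (r.+2 <= i)%N by rewrite ltn_neqAle eq_sym ne.
  by move/leq_sizeP: sq => /(_ _ ri2) ->; rewrite mulr0 subr0.
- move=> i; rewrite coefD coefB !coefCM coefXn.
  have [a Aa ->] := qA i; have [b Ab ->] := qA r.+1; have [c Ac ->] := kA i.
  exists (a - b * (i == r.+1)%:R + P * b * c); last by ring.
  apply: AD; last by apply: AM => //; apply: AM.
  by apply: AB => //; apply: AM => //; case: (_ == _).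
by rewrite !hornerE zk q1; ring.
Qed.

Lemma maximal_total z : z != 0 -> A z \/ A z^-1.
Proof.
move=> z0; apply: contrapT => /not_orP[Az Az'].
have rel y : ~ A y -> exists r, unit_relation y r.
  move=> /maximal_adjoin[q [qA qy]]; exists (size q), (P *: q); split.
  - by apply: leq_trans (size_scale_leq _ _) _.
  - by move=> i; exists q`_i; rewrite ?coefZ.
  - by rewrite hornerZ qy mulfV.
have [r hr] := rel z Az; have [s hs] := rel _ Az'.
exact: (no_two_unit_relations z0 (leqnn _) hr hs).
Qed.

End Maximal.

Lemma valuation_ring_without_pV :
  exists V : {pred M}, is_valuation_ring V /\ P^-1 \notin V.
Proof.
have [A [A_ok A1 Amax]] := maximal_subring_without_pV.
pose V : {pred M} := fun x => `[< A x >].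
exists V; split; last first.
  by apply/asboolPn; case: A_ok.
split.
- exact/asboolP.
- by move=> x y /asboolP Ax /asboolP Ay; apply/asboolP; case: A_ok => + _ _ _; apply.
- by move=> x y /asboolP Ax /asboolP Ay; apply/asboolP; case: A_ok => _ + _ _; apply.
- by move=> x x0; case: (maximal_total A_ok A1 Amax x0) => h; [left|right]; apply/asboolP.
Qed.

(** The valuation ring given by Zorn's lemma carries no integer-valued valuation a priori. One is
    built from finiteness of the degree [n]: the exponents in [power_rational_unit] are at most [n],
    so [n!] is a common multiple of them. The resulting map takes the value [n!] at [p] and is then
    normalized. *)
Lemma place_over_exists : exists w : M -> int, is_valuation w /\ 0 < w P.
Proof.
have [V [VV PV]] := valuation_ring_without_pV.
pose U : {pred M} := [pred x | (x \in V) && (x^-1 \in V)].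
have U1 : 1 \in U by rewrite inE invr1 valring1.
have UM x y : x \in U -> y \in U -> x * y \in U.
  by rewrite !inE invfM => /andP[? ?] /andP[? ?]; rewrite !valringM.
have UV x : x \in U -> x^-1 \in U by rewrite !inE invrK andbC.
have UX x n : x \in U -> x ^+ n \in U.
  by move=> Ux; elim: n => [|n IH]; rewrite ?expr0 ?exprS ?UM.
have Pmax : P \in valring_max V by rewrite inE valring_nat // PV orbT.
have natU m : ~~ (p %| m)%N -> m%:R \in U.
  move=> pm; rewrite inE valring_nat //=; apply/negPn/negP => mV.
  have [a [b E]] := bezout_coprime p_prime pm.
  have : 1 \in valring_max V.
    have -> : 1 = a%:R * m%:R + - b%:R * P :> M.
      by rewrite /P mulNr -!natrM E natrD addrC addKr.
    have maxM x y : x \in V -> y \in valring_max V -> x * y \in valring_max V.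
      rewrite !inE => xV /andP[yV yV']; rewrite valringM //=.
      have [//|xy0 /=] := eqVneq (x * y) 0.
      have [y0|y0] := eqVneq y 0; first by rewrite y0 mulr0 eqxx in xy0.
      have [x0|x0] := eqVneq x 0; first by rewrite x0 mul0r eqxx in xy0.
      move: yV'; rewrite (negPf y0) /=; apply: contra => h.
      rewrite (_ : y^-1 = x * (x * y)^-1); first by rewrite valringM.
      by field; rewrite x0 y0.
    apply: valring_maxD => //; apply: maxM => //.
    - exact: valring_nat.
    - by rewrite inE valring_nat // mV orbT.
    - by rewrite valringN ?valring_nat.
  by rewrite inE oner_eq0 invr1 valring1 //= valring1.
have nat_pow m : (0 < m)%N -> m%:R / P ^+ logn p m \in U.
  move=> m0; have [m' cop E] := pfactor_coprime p_prime m0.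
  rewrite {1}E natrM natrX mulfK ?expf_neq0 //; apply: natU.
  by rewrite -prime_coprime.
have int_pow (m : int) : m != 0 -> m%:~R / P ^+ logn p `|m| \in U.
  move=> m0; have := nat_pow `|m|%N; rewrite absz_gt0 => /(_ m0).
  have [h|h] := leP 0 m; first by rewrite -{3}(gez0_abs h).
  rewrite !inE; have -> : m%:~R = - (`|m|%N)%:R :> M.
    transitivity ((- (`|m|%N : int))%:~R : M); last by rewrite rmorphN.
    by congr (_%:~R); lia.
  by rewrite mulNr invrN => /andP[h1 h2]; rewrite !valringN.
have rat_pow (r : rat) : r != 0 -> exists l : int, r%:A / P ^ l \in U.
  move=> r0; exists (padic p r).
  have h1 := int_pow _ (denq_neq0 r).
  have h2 : (numq r)%:~R / P ^+ logn p `|numq r| \in U by apply: int_pow; rewrite numq_eq0.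
  have -> : r%:A = (numq r)%:~R / (denq r)%:~R :> M.
    by rewrite -in_algE -[in LHS](divq_num_den r) fmorph_div !rmorph_int.
  have := UM _ _ h2 (UV _ h1).
  by rewrite /padic expfzDr // -exprnN !invfM !invrK mulrACA.
(* [x ^ N] is a power of [p] up to a unit of [V], for every nonzero [x]; the
   exponent of that power is a multiple of the valuation. *)
set n := \dim {:M}; pose N := n`!.
have N0 : (0 < N)%N by apply: fact_gt0.
have PV_notin k : (P ^+ k.+1)^-1 \in V -> False.
  move=> h; move/negP: PV; apply.
  have -> : P^-1 = P ^+ k * (P ^+ k.+1)^-1.
    by rewrite exprS invfM mulrCA mulfV ?expf_neq0 // mulr1.
  by rewrite valringM // valringX // valring_nat.
have PX_U (l : int) : P ^ l \in U -> l = 0.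
  case: l => [[|k]|k] //; rewrite inE; first by case/andP=> _ /PV_notin.
  by rewrite NegzE -exprnN; case/andP=> /PV_notin.
have pow_exists x : exists l : int, x != 0 -> x ^+ N / P ^ l \in U.
  have [->|x0] := eqVneq x 0; first by exists 0.
  have [k [r [/andP[k0 kn] r0 h1 h2]]] := power_rational_unit VV x0.
  have [l hl] := rat_pow r r0.
  have hk : x ^+ k / r%:A \in U by rewrite inE h1 invf_div.
  have rA0 : r%:A != 0 :> M by rewrite -in_algE fmorph_eq0.
  have := UM _ _ hk hl; rewrite mulrA divfK // => /(UX _ (N %/ k)%N).
  rewrite exprMn -exprM mulnC divnK; last first.
    by rewrite dvdn_fact // k0.
  exists (l * (N %/ k)%N%:Z) => _.
  by rewrite -exprz_exp /= -exprVn.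
have [kap0 kapP] := choice pow_exists.
pose kap x := if x == 0 then 0 else kap0 x.
have kapU x : x != 0 -> x ^+ N / P ^ kap x \in U.
  by move=> x0; rewrite /kap (negPf x0) kapP.
have kapE x l : x != 0 -> x ^+ N / P ^ l \in U -> kap x = l.
  move=> x0 h; have := UM _ _ h (UV _ (kapU x x0)).
  have -> : x ^+ N / P ^ l * (x ^+ N / P ^ kap x)^-1 = P ^ (kap x - l).
    rewrite expfzDr // -invr_expz.
    have := expfz_neq0 l P0; have := expfz_neq0 (kap x) P0; have := expf_neq0 N x0.
    move: (P ^ l) (P ^ kap x) (x ^+ N) => a b c c0 b0 a0.
    by field; rewrite a0 b0 c0.
  by move/PX_U/eqP; rewrite subr_eq0 => /eqP.
have kapM x y : x != 0 -> y != 0 -> kap (x * y) = kap x + kap y.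
  move=> x0 y0; apply: kapE; first exact: mulf_neq0.
  by rewrite exprMn expfzDr // invfM mulrACA UM ?kapU.
(* Only [z ^ N] is directly seen to be in [V]. If [z^-1] is in [V], then so is [z], the product of
   [z ^ N] and [N - 1] copies of [z^-1]. *)
have kapV z : z != 0 -> 0 <= kap z -> z \in V.
  move=> z0; have := kapU z z0; case: (kap z) => // k hk _.
  have [//|zV] := valring_total VV z0.
  have zN : z ^+ N \in V.
    rewrite -(divfK (expf_neq0 k P0) (z ^+ N)) valringM //.
      by case/andP: hk.
    by rewrite valringX // valring_nat.
  have -> : z = z ^+ N * z^-1 ^+ N.-1.
    by rewrite exprVn -[in z ^+ N](prednK N0) exprS mulfK ?expf_neq0.
  by rewrite valringM // valringX.
have V_kap z : z != 0 -> z \in V -> 0 <= kap z.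
  move=> z0 zV; have := kapU z z0; case: (kap z) => // k /andP[_ hk].
  exfalso; apply: (@PV_notin k).
  have -> : (P ^+ k.+1)^-1 = z ^+ N * (z ^+ N / P ^ Negz k)^-1.
    by rewrite invf_div NegzE -exprnN mulrCA mulfV ?expf_neq0 // mulr1.
  by rewrite valringM // valringX.
have kapD x y : x != 0 -> y != 0 -> x + y != 0 ->
    Num.min (kap x) (kap y) <= kap (x + y).
  wlog le_xy : x y / kap x <= kap y.
    move=> wl x0 y0 xy0; have [|/ltW] := leP (kap x) (kap y).
      by move=> h; have := wl x y h x0 y0 xy0; rewrite (min_idPl h).
    by move=> h; have := wl y x h y0 x0; rewrite addrC (min_idPl h) => /(_ xy0).
  move=> x0 y0 xy0; rewrite (min_idPl le_xy).
  have yx0 : y / x != 0 by rewrite mulf_neq0 ?invr_neq0.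
  have E : x * (1 + y / x) = x + y by rewrite mulrDr mulr1 mulrC divfK.
  have u0 : 1 + y / x != 0 by apply: contraNneq xy0 => h; rewrite -E h mulr0.
  rewrite -E kapM // lerDl V_kap // valringD ?valring1 // kapV //.
  by have := kapM _ _ yx0 x0; rewrite divfK // => h; rewrite h lerDr in le_xy.
have kapP' : kap P = N%:Z by apply: kapE => //; rewrite -[P ^ N]/(P ^+ N) mulfV ?expf_neq0.
have kap00 : kap 0 = 0 by rewrite /kap eqxx.
have kap_nontriv : exists x, kap x != 0 by exists P; rewrite kapP' eqz_nat -lt0n.
have [e [w [e0 ww wE]]] := normalize_valuation kap00 kapM kapD kap_nontriv.
by exists w; split=> //; move: (wE P); rewrite kapP'; nia.
Qed.

End Existence.

(** * Residue fields and places over a prime *)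

Section Places.
Variable L : fieldExtType rat.
Implicit Types w : L -> int.

Lemma residue_cardE w (T : finType) (r : T -> L) : is_valuation w ->
  reps (vball w 0) (vball w 1) r -> residue_card w = #|T|.
Proof.
move=> ww [rA r_inj r_onto].
have idealE x : valuation_ideal w x <-> x \in vball w 1.
  rewrite inE /valuation_ideal /=; split.
    by case=> [->|]; rewrite ?eqxx // -lez1D addr0 orbC => ->.
  by case/orP => [/eqP->|h]; [left|right; lia].
have ringE x : valuation_ring w x <-> x \in vball w 0.
  rewrite inE /valuation_ring /=; split; first by case=> [->|->]; rewrite ?eqxx ?orbT.
  by case/orP => [/eqP->|h]; [left|right].
pose f t : set L := [set y | valuation_ideal w (y - r t)].
have f_inj : injective f.
  move=> t u ftu; apply: r_inj; apply/idealE.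
  have : f t (r t) by rewrite /f /= subrr; left.
  by rewrite ftu.
rewrite /residue_card.
suff -> : fset_set (residue_classes w) = [fset f t | t in T]%fset.
  by rewrite card_imfset //= -cardE.
have -> : residue_classes w = [set` [fset f t | t in T]%fset].
  apply/seteqP; split=> A /=.
    case=> x /ringE /r_onto[t xt] <-; apply/imfsetP; exists t => //.
    apply/seteqP; split=> y /= /idealE h; apply/idealE.
      by rewrite -(subrKA x) vballD.
    by rewrite -(subrKA (r t)) vballD // -opprB vballN.
  by case/imfsetP => t _ ->; exists (r t) => //; apply/ringE/rA.
by rewrite set_fsetK.
Qed.

(** A rational of positive valuation has a numerator of positive valuation. Splitting off smallest
    prime factors, the valuation stays positive on the cofactor until a suitable prime is met. *)
Lemma place_over_prime w : is_valuation w -> exists p, prime p /\ 0 < w p%:R.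
Proof.
move=> ww; have [r r0 wr] := valuation_nontrivial_rat ww.
have intw (m : int) : 0 <= w m%:~R.
  have nat_ge0 k : 0 <= w k%:R.
    by have := vball_nat ww k; rewrite inE => /orP[/eqP->|//]; rewrite val0.
  by case: m => k; rewrite ?NegzE ?rmorphN ?valN //; apply: nat_ge0.
have den0 : (denq r)%:~R != 0 :> L.
  by rewrite -(rmorph_int (in_alg L)) fmorph_eq0 intr_eq0 denq_neq0.
have num0 : (numq r)%:~R != 0 :> L.
  by rewrite -(rmorph_int (in_alg L)) fmorph_eq0 intr_eq0 numq_eq0.
have : 0 < w (`|numq r|%N)%:R.
  have -> : w (`|numq r|%N)%:R = w (numq r)%:~R.
    have [h|h] := leP 0 (numq r); first by rewrite -[in RHS](gez0_abs h).
    by rewrite -[RHS]valN // -rmorphN -ltz0_abs.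
  move: wr; have -> : r%:A = (numq r)%:~R / (denq r)%:~R :> L.
    by rewrite -in_algE -[in LHS](divq_num_den r) fmorph_div !rmorph_int.
  by rewrite valM ?invr_neq0 // valV // subr_gt0; apply: le_lt_trans (intw _).
have : (0 < `|numq r|)%N by rewrite absz_gt0 numq_eq0.
elim/ltn_ind: `|numq r|%N => m IH m0 wm.
have [m1|m1] := leqP m 1.
  by move: wm; rewrite (_ : m = 1%N) ?val1 //; lia.
have pp := pdiv_prime m1; have [|wp] := ltP 0 (w (pdiv m)%:R); first by exists (pdiv m).
have mE : m = (m %/ pdiv m * pdiv m)%N by rewrite divnK ?pdiv_dvd.
have d0 : (0 < m %/ pdiv m)%N by rewrite divn_gt0 ?prime_gt0 // dvdn_leq ?pdiv_dvd.
apply: (IH (m %/ pdiv m)%N) => //; first by rewrite ltn_Pdiv ?prime_gt1.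
have dn0 := nat_alg_neq0 L d0; have qn0 := nat_alg_neq0 L (prime_gt0 pp).
by move: wm; rewrite {1}mE natrM valM // => /lt_le_trans; apply; rewrite gerDl.
Qed.

End Places.

Lemma padic_residue_card p : prime p -> is_valuation (padic p) ->
  @residue_card rat^o (padic p) = p.
Proof.
move=> pp pv.
by rewrite (residue_cardE (w := padic p : rat^o -> int) pv (padic_residue pp pv)) card_ord.
Qed.

(** [finite_residue] for the single place [w] over the [p]-adic valuation, with ramification index
    [w p]. *)
Lemma residue_reps (L : fieldExtType rat) (w : L -> int) : is_valuation w ->
  exists (T : finType) (r : T -> L), reps (vball w 0) (vball w 1) r.
Proof.
move=> ww; have [p [pp wp]] := place_over_prime ww.
have pv := padic_valuation ww pp wp.
have wE (i : unit) c : w (in_alg L c) = (`|w p%:R|%N)%:Z * padic p c.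
  by rewrite gez0_abs ?ltW //; apply: val_rat.
have := @finite_residue rat L (in_alg L) (padic p) unit (fun=> w) (fun=> `|w p%:R|%N)
  pv (fun=> ww) wE 1%N (\dim {:L}) isT _ _ _ tt.
apply => //; last exact: padic_residue.
- move=> s b b_free; have := @free_dimension rat^o L (in_alg L) s b b_free.
  by rewrite dimvf /= /dim /=.
- by move: wp; case: (w p%:R) => [[]|].
- by case.
Qed.

Lemma residue_card_gt1 (L : fieldExtType rat) (w : L -> int) :
  is_valuation w -> (1 < residue_card w)%N.
Proof.
move=> ww; have [T [r hr]] := residue_reps ww.
rewrite (residue_cardE ww hr) -card_bool; have [_ _ onto] := hr.
apply: (reps_card_le (A := vball w 0) (B := vball w 1) (r := fun b : bool => b%:R)) onto.
- by move=> x y; apply: vballB.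
- by case; rewrite ?vball1 ?vball0.
- by move=> [] [] //; rewrite ?subr0 ?sub0r ?vballN // vballE ?oner_eq0 // val1.
Qed.

(* [sum e_i f_i = s <= dim M / dim L] for the places [w i] over [v]. *)
Lemma local_degrees (L M : fieldExtType rat) (iota : {rmorphism L -> M})
    (v : L -> int) (I : finType) (w : I -> M -> int) (e : I -> nat) :
  is_valuation v -> (forall i, is_valuation (w i)) -> injective w ->
  (forall i c, w i (iota c) = (e i)%:Z * v c) ->
  exists s (b : 'I_s -> M),
    [/\ (forall j, b j \in [pred x | [forall i, x \in vball (w i) 0]]),
        spans_mod iota v w e b, (s * \dim {:L} <= \dim {:M})%N
      & (\prod_i residue_card (w i) ^ e i)%N = (residue_card v ^ s)%N].
Proof.
move=> vv ww w_inj wv.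
have L0 : (0 < \dim {:L})%N by rewrite adim_gt0.
have free_dim s b := @free_dimension L M iota s b.
have [s [b [bW ib sb sdim]]] := maximal_indep_mod vv ww wv L0 free_dim.
exists s, b; split=> //.
have [T [r hr]] := residue_reps vv; rewrite (residue_cardE vv hr).
have /choice[Tw hTw] i := residue_reps (ww i).
have {}hTw i := cid (hTw i).
rewrite -(residue_count vv ww wv hr bW ib sb w_inj (fun i => svalP (hTw i))).
by apply: eq_bigr => i _; rewrite (residue_cardE (ww i) (svalP (hTw i))).
Qed.

Definition places_over (L : fieldExtType rat) (p : nat) : set (L -> int) :=
  [set w | is_valuation w /\ 0 < w p%:R].

Lemma finite_places_over (L : fieldExtType rat) p : prime p ->
  finite_set (@places_over L p).
Proof.
move=> pp; apply: contrapT => /infinite_set_fset inf.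
(* Each place contributes a factor at least 2 to a product equal to [p ^ s], and
   [p ^ s <= (2 ^ p) ^ dim]; hence at most [dim * p] places exist. *)
have [B BP Bcard] := inf (\dim {:L} * p).+1.
have Bval (i : B) : is_valuation (val i) by case: (BP _ (valP i)).
have Bp (i : B) : 0 < val i p%:R by case: (BP _ (valP i)).
have : (0 < #|` B|)%N by apply: leq_trans Bcard.
rewrite cardfs_gt0 => /fset0Pn[w0 w0B]; pose i0 : B := [` w0B]%fset.
have pv := padic_valuation (Bval i0) pp (Bp i0).
have wE (i : B) c : val i (in_alg L c) = (`|val i p%:R|%N)%:Z * padic p c.
  by rewrite gez0_abs ?ltW //; apply: val_rat.
have [s [b [_ _ sdim]]] := @local_degrees rat^o L (in_alg L) (padic p) B
  (fun i => val i) (fun i => `|val i p%:R|%N) pv Bval val_inj wE.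
rewrite padic_residue_card // => E.
have : (\prod_(i : B) 2 <= \prod_(i : B) residue_card (val i) ^ `|val i p%:R|)%N.
  apply: leq_prod => i _; apply: leq_trans (residue_card_gt1 (Bval i)) _.
  rewrite -{1}[residue_card _]expn1 leq_pexp2l ?(ltnW (residue_card_gt1 _)) //.
  by rewrite absz_gt0 gt_eqF.
rewrite E prod_nat_const -cardfE.
move: sdim; rewrite {1}dimvf /= /dim /= muln1 => sdim.
have : (p ^ s <= (2 ^ p) ^ \dim {:L})%N.
  apply: leq_trans (_ : p ^ \dim {:L} <= _)%N; first by rewrite leq_pexp2l ?prime_gt0.
  by rewrite leq_exp2r ?adim_gt0 // ltnW // ltn_expl.
by rewrite -expnM => h1 /leq_trans/(_ h1); rewrite leq_exp2l // leqNgt mulnC Bcard.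
Qed.

(** * Galois number fields *)

Section Automorphism.
Variables (M : fieldExtType rat) (f f' : {rmorphism M -> M}).
Hypothesis f'K : cancel f' f.

Lemma valuation_aut (w : M -> int) : is_valuation w -> is_valuation (w \o f).
Proof.
move=> ww; split.
- by rewrite /= rmorph0 val0.
- by move=> x y x0 y0; rewrite /= rmorphM valM ?fmorph_eq0.
- move=> x y x0 y0 xy0; rewrite /= rmorphD.
  by have [_ _ + _] := ww; apply; rewrite -?rmorphD ?fmorph_eq0.
have [x x0 wx] := uniformizer ww; exists (f' x); first by rewrite fmorph_eq0.
by rewrite /= f'K.
Qed.

Lemma residue_card_aut (w : M -> int) : is_valuation w ->
  residue_card (w \o f) = residue_card w.
Proof.
move=> ww; have [T [r hr]] := residue_reps ww.
rewrite (residue_cardE ww hr); have [rA r_inj r_onto] := hr.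
have ballE x k : (x \in vball (w \o f) k) = (f x \in vball w k).
  by rewrite !inE /= fmorph_eq0.
apply: (residue_cardE (r := fun t => f' (r t)) (valuation_aut ww)); split.
- by move=> t; rewrite ballE f'K; apply: rA.
- by move=> t u; rewrite ballE rmorphB !f'K; apply: r_inj.
- move=> x; rewrite ballE => /r_onto[t xt]; exists t.
  by rewrite ballE rmorphB f'K.
Qed.

End Automorphism.

Section Galois.
Variable M : splittingFieldType rat.
Local Notation G := ('Gal({:M} / 1))%g.
Implicit Types g : gal_of {:M}.

Lemma galois_number_field : galois 1 {:M}.
Proof.
apply/and3P; split; [exact: sub1v| |exact: normalFieldf].
apply/separableP => x _; apply: pcharf0_separable => p.
by rewrite pchar_lalg pchar_num.
Qed.

Lemma gal_fixes_rat g (r : rat) : g r%:A = r%:A.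
Proof. by rewrite linearZ /= rmorph1. Qed.

Lemma galKV g : cancel (g^-1)%g g.
Proof. by move=> x; rewrite -galM ?memvf // mulVg gal_id. Qed.

Lemma valuation_gal g (w : M -> int) : is_valuation w -> is_valuation (w \o g).
Proof. exact: valuation_aut (galKV g) _. Qed.

Lemma residue_card_gal g (w : M -> int) : is_valuation w ->
  residue_card (w \o g) = residue_card w.
Proof. exact: residue_card_aut (galKV g) _. Qed.

Lemma place_over_gal g p (w : M -> int) :
  places_over p w -> places_over p (w \o g).
Proof.
move=> [ww wp]; split; first exact: valuation_gal.
by rewrite /= rmorph_nat.
Qed.

Lemma trace_rational x : exists r : rat, galTrace 1 {:M} x = r%:A.
Proof.
by have /vlineP := mem_galTrace galois_number_field (memvf x).
Qed.

Lemma norm_rational x : exists r : rat, galNorm 1 {:M} x = r%:A.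
Proof.
by have /vlineP := mem_galNorm galois_number_field (memvf x).
Qed.

Lemma trace_rat (r : rat) : galTrace 1 {:M} r%:A = (r *+ #|G|)%:A.
Proof.
rewrite /galTrace (eq_bigr (fun=> r%:A)); last by move=> g _; apply: gal_fixes_rat.
by rewrite sumr_const scalerMnl.
Qed.

Lemma traceZ (r : rat) x : galTrace 1 {:M} (r *: x) = r *: galTrace 1 {:M} x.
Proof.
by rewrite /galTrace scaler_sumr; apply: eq_bigr => g _; rewrite linearZ.
Qed.

(** The map sending [u] to the tuple of traces of [u * b j] goes from [M] to a rational space of
    smaller dimension, so its kernel is nonzero. *)
Lemma trace_orthogonal s (b : 'I_s -> M) : (s < \dim {:M})%N ->
  exists2 u, u != 0 & forall j, galTrace 1 {:M} (u * b j) = 0.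
Proof.
move=> s_lt; have /choice[t tE] := trace_rational.
have A_inj : injective (fun r : rat => r%:A : M) := fmorph_inj (in_alg M).
pose f (u : M) : {ffun 'I_s -> rat^o} := [ffun j => t (u * b j)].
have f_lin : linear f.
  move=> a u v; apply/ffunP => j; rewrite !ffunE; apply: A_inj => /=.
  rewrite scalerDl -scalerA -!tE mulrDl raddfD /= -scalerAl traceZ.
  by [].
pose fM := GRing.isLinear.Build rat M {ffun 'I_s -> rat^o} *:%R f f_lin.
pose fL : {linear M -> {ffun 'I_s -> rat^o}} := HB.pack f fM.
have ker0 : lker (linfun fL) != 0%VS.
  apply: contraTneq s_lt => ker0; rewrite -leqNgt.
  rewrite -(@limg_dim_eq _ _ _ (linfun fL) fullv) ?ker0 ?capv0 //.
  apply: leq_trans (dimvS (subvf _)) _.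
  by rewrite dimvf /= /dim /= card_ord muln1.
exists (vpick (lker (linfun fL))); first by rewrite vpick0.
move=> j; have := memv_pick (lker (linfun fL)).
rewrite memv_ker lfunE /= => /eqP/ffunP/(_ j); rewrite !ffunE tE => ->.
by rewrite scale0r.
Qed.

Section LocalDegreeSum.
Variables (p : nat) (B : {fset (M -> int)}).
Hypotheses (p_prime : prime p) (B_places : [set` B] = @places_over M p).
Let W : {pred M} := [pred x | [forall w : B, x \in vball (val w) 0]].

Let Bval (w : B) : is_valuation (val w).
Proof. by have : [set` B] (val w) := valP w; rewrite B_places => -[]. Qed.

Let Bp (w : B) : 0 < val w p%:R.
Proof. by have : [set` B] (val w) := valP w; rewrite B_places => -[]. Qed.

Let P0 : p%:R != 0 :> M.
Proof. by rewrite nat_alg_neq0 ?prime_gt0. Qed.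

Let B_rat (w : B) (r : rat) : val w r%:A = val w p%:R * padic p r.
Proof. exact: val_rat. Qed.

Let ex_B : exists w : B, true.
Proof.
have [w [ww wp]] := place_over_exists M p_prime.
have wB : w \in B by have : [set` B] w by rewrite B_places.
by exists [` wB]%fset.
Qed.

Let W_mul x y : x \in W -> y \in W -> x * y \in W.
Proof.
move=> /forallP xW /forallP yW; apply/forallP => w.
by rewrite -[0]addr0 vballM.
Qed.

Let W_scale y : y != 0 -> exists a, p%:R ^+ a * y \in W.
Proof.
move=> y0; exists (\max_(w : B) `|val w y|)%N; apply/forallP => w.
rewrite vballE ?mulf_neq0 ?expf_neq0 // valM ?expf_neq0 // valX //.
have := @leq_bigmax _ (fun w : B => `|val w y|%N) w; have := Bp w.
move: (val w p%:R) (val w y) (\max_(w : B) _)%N => c d m c0 dm.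
have : m%:Z <= c * m%:Z by rewrite ler_peMl.
by lia.
Qed.

(** [w \o g] is again a place above [p], so every conjugate of an element of [W] is integral at
    [w]. *)
Let W_trace x r : x \in W -> galTrace 1 {:M} x = r%:A -> 0 <= padic p r.
Proof.
move=> /forallP xW tr; have [w _] := ex_B.
have : galTrace 1 {:M} x \in vball (val w) 0.
  apply: vball_sum => // g _; have wg := place_over_gal g (conj (Bval w) (Bp w)).
  have wgB : val w \o g \in B by have : [set` B] (val w \o g) by rewrite B_places.
  by have := xW [` wgB]%fset; rewrite !inE /= fmorph_eq0.
rewrite tr; have [->|r0] := eqVneq r 0; first by rewrite padic0.
rewrite vballE -?in_algE ?fmorph_eq0 // in_algE B_rat.
by rewrite pmulr_rge0.
Qed.

(** The ramification index of [w] is [w p]. Writing residue cardinalities as [p ^ f_w], this is the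
    identity [sum e_w f_w = dim M]. *)
Lemma local_degree_sum :
  (\prod_(w : B) residue_card (val w) ^ `|val w p%:R| = p ^ \dim {:M})%N.
Proof.
have [w0 _] := ex_B.
have pv := padic_valuation (Bval w0) p_prime (Bp w0).
have wE (w : B) c : val w (in_alg M c) = (`|val w p%:R|%N)%:Z * padic p c.
  by rewrite gez0_abs ?ltW // B_rat.
have [s [b [bW b_spans sdim ->]]] := @local_degrees rat^o M (in_alg M) (padic p) B
  (fun w => val w) (fun w => `|val w p%:R|%N) pv Bval val_inj wE.
rewrite padic_residue_card //; congr (_ ^ _)%N.
move: sdim; rewrite {1}dimvf /= /dim /= muln1 leq_eqVlt => /orP[/eqP //|s_lt].
exfalso.
(* Take [u != 0] orthogonal to all [b j] for the trace form.  Approximating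
   [p ^ a' / u] by combinations of the [b j] modulo [p ^ k] shows that the
   nonzero rational [Tr (p ^ (a + a'))] is divisible by [p ^ k] for all [k]. *)
have [u u0 ub] := trace_orthogonal b s_lt.
have [a uW] := W_scale u0; have [a' xW] := W_scale (invr_neq0 u0).
set u' := p%:R ^+ a * u in uW; set x := p%:R ^+ a' * u^-1 in xW.
have approx k : exists (c : 'I_s -> rat) z, z \in W /\
    x = \sum_j (c j)%:A * b j + (p%:R ^+ k) * z.
  elim: k => [|k [c [z [zW xE]]]].
    exists (fun=> 0), x; split=> //; rewrite expr0 mul1r big1 ?add0r // => j _.
    by rewrite scale0r mul0r.
  have [d [_ zd]] := b_spans z zW.
  exists (fun j => c j + p%:R ^+ k * d j), ((z - \sum_j (d j)%:A * b j) / p%:R).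
  split.
    apply/forallP => w; move/forallP: zd => /(_ w).
    set y := z - _ => yw; rewrite -(vball_mul_val (Bval w) _ _ P0) addr0.
    by rewrite mulrC divfK // -[val w _]gez0_abs // ltW.
  rewrite xE exprSr -mulrA [p%:R * _]mulrC divfK //.
  have -> : \sum_j (c j + p%:R ^+ k * d j)%:A * b j =
      \sum_j (c j)%:A * b j + p%:R ^+ k * \sum_j (d j)%:A * b j.
    rewrite mulr_sumr -big_split; apply: eq_bigr => j _ /=.
    rewrite -!in_algE rmorphD rmorphM rmorphXn rmorph_nat /=; ring.
  by ring.
have [r trE] := trace_rational (u' * x).
have r0 : r != 0.
  have E : u' * x = (p%:R ^+ (a + a') : rat)%:A.
    rewrite -in_algE rmorphXn rmorph_nat exprD /u' /x mulrACA mulfV // mulr1 //.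
  move: trE; rewrite E trace_rat => /(fmorph_inj (in_alg M)) <-.
  by rewrite mulrn_eq0 negb_or -lt0n fingroup.cardG_gt0 expf_neq0 // pnatr_eq0 -lt0n prime_gt0.
have [c [z [zW xE]]] := approx `|padic p r|.+1.
have [r' tr'] := trace_rational (u' * z).
have r'0 := W_trace (W_mul uW zW) tr'.
have : r = p%:R ^+ `|padic p r|.+1 * r'.
  apply: (fmorph_inj (in_alg M)); rewrite rmorphM /= -trE -tr' xE mulrDr raddfD /=.
  rewrite mulrCA -(rmorph_nat (in_alg M)) -rmorphXn /= !mulr_algl traceZ.
  rewrite mulr_sumr raddf_sum /= big1 ?add0r // => j _.
  rewrite mulrCA mulr_algl traceZ /u' -mulrA -(rmorph_nat (in_alg M)) -rmorphXn /=.
  by rewrite mulr_algl traceZ ub !scaler0.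
move=> rE; have r'n0 : r' != 0 by apply: contraNneq r0 => r'0'; rewrite rE r'0' mulr0.
have pn0 : p%:R != 0 :> rat by rewrite pnatr_eq0 -lt0n prime_gt0.
have := congr1 (padic p) rE.
rewrite [in RHS](valM pv) ?expf_neq0 // (valX pv) padicp //; lia.
Qed.

End LocalDegreeSum.
End Galois.

(** * Sums over the finite places *)

Lemma partition_big_fset (V : nmodType) (I : eqType) (J : choiceType) (A : seq I)
    (B : {fset J}) (h : I -> J) (F : I -> V) : (forall i, i \in A -> h i \in B) ->
  \sum_(i <- A) F i = \sum_(j <- B) \sum_(i <- A | h i == j) F i.
Proof.
move=> hAB; rewrite (exchange_big_dep xpredT) //=.
rewrite big_seq [RHS]big_seq; apply: eq_bigr => i iA.
rewrite (eq_bigl (pred1 (h i))); last by move=> j; rewrite /= eq_sym.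
by rewrite -big_filter filter_pred1_uniq ?fset_uniq ?hAB // big_seq1.
Qed.

Definition lnq (R : realType) (L : fieldExtType rat) (w : L -> int) : R :=
  ln (residue_card w)%:R.

(** Finite stocks of places that exhaust all finite places as [K] grows; they serve as common
    supports for sums attached to several elements. [fset_set] is faithful here thanks to
    [finite_places_over]. *)
Definition places_le (L : fieldExtType rat) (K : nat) : {fset (L -> int)} :=
  fset_set (\bigcup_(p in [set p | prime p /\ (p <= K)%N]) @places_over L p).

Definition places_at (L : fieldExtType rat) (p : nat) : {fset (L -> int)} :=
  fset_set (@places_over L p).

Lemma places_leP (L : fieldExtType rat) K (w : L -> int) :
  reflect (is_valuation w /\ exists p, [/\ prime p, (p <= K)%N & 0 < w p%:R])
    (w \in places_le L K).
Proof.
rewrite in_fset_set; last first.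
  apply: bigcup_finite; last by move=> p [pp _]; apply: finite_places_over.
  by apply: (sub_finite_set _ (finite_II K.+1)) => p [_ pK] /=; rewrite ltnS.
apply: (iffP idP).
  by rewrite inE => -[p [pp pK] [ww wp]]; split=> //; exists p.
by move=> [ww [p [pp pK wp]]]; rewrite inE; exists p.
Qed.

Lemma places_atP (L : fieldExtType rat) p (w : L -> int) : prime p ->
  reflect (is_valuation w /\ 0 < w p%:R) (w \in places_at L p).
Proof.
move=> pp; rewrite in_fset_set; last exact: finite_places_over.
by apply: (iffP idP) => [|h]; rewrite inE.
Qed.

(** [K] bounds all numerators and denominators in a rational relation of [x]. For [w] above [p > K]
    the coefficients are units, so two terms of equal valuation give [w x * (i - j) = 0] with
    [i != j]. *)
Lemma finite_support_valuation (L : fieldExtType rat) (x : L) : exists K : nat,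
  forall w, is_valuation w -> w x != 0 -> w \in places_le L K.
Proof.
have [c [cx [i0 ci0]]] := rational_relation x.
pose K := (\max_i maxn `|numq (c i)| `|denq (c i)|)%N.
exists K => w ww wx; apply/places_leP; split=> //.
have x0 : x != 0 by apply: contraNneq wx => ->; rewrite val0.
have alg0 (r : rat) : (r%:A == 0 :> L) = (r == 0) by rewrite -in_algE fmorph_eq0.
have [p [pp wp]] := place_over_prime ww; exists p; split=> //.
have [|i [j [ij]]] := valring_cancel (vball_valuation_ring ww) cx.
  by exists i0; rewrite mulf_neq0 ?alg0 ?expf_neq0.
move=> ti tj; have xn0 k : x ^+ k != 0 by rewrite expf_neq0.
have ci : c i != 0 by apply: contraNneq ti => ->; rewrite scale0r mul0r.
have cj : c j != 0 by apply: contraNneq tj => ->; rewrite scale0r mul0r.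
rewrite !vballE ?mulf_neq0 ?invr_neq0 ?alg0 // !valM ?mulf_neq0 ?invr_neq0 ?alg0 //.
rewrite !valV // !valM ?alg0 // !valX // !(val_rat _ ww pp wp) => h1 h2.
have padicK k : c k != 0 -> padic p (c k) != 0 -> (p <= K)%N.
  move=> ck; rewrite /padic => h.
  have [lognum|] := posnP (logn p `|numq (c k)|); last first.
    rewrite logn_gt0 mem_primes => /and3P[_ n0 /(dvdn_leq n0)] /leq_trans; apply.
    apply: leq_trans (leq_maxl _ _) _.
    exact: (@leq_bigmax _ (fun i => maxn `|numq (c i)| `|denq (c i)|)%N k).
  have : (0 < logn p `|denq (c k)|)%N by move: h; rewrite lognum; lia.
  rewrite logn_gt0 mem_primes => /and3P[_ n0 /(dvdn_leq n0)] /leq_trans; apply.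
  apply: leq_trans (leq_maxr _ _) _.
  exact: (@leq_bigmax _ (fun i => maxn `|numq (c i)| `|denq (c i)|)%N k).
have [i0'|] := eqVneq (padic p (c i)) 0; last exact: padicK.
have [j0'|] := eqVneq (padic p (c j)) 0; last exact: padicK.
exfalso; move: h1 h2; rewrite i0' j0' mulr0 !add0r => h1 h2.
have : w x * (i%:Z - j%:Z) = 0 by rewrite mulrBr; lia.
move/eqP; rewrite mulf_eq0 (negPf wx) subr_eq0 eqz_nat /= => /eqP/val_inj/eqP.
by rewrite (negPf ij).
Qed.

Lemma sum_finite_places (R : realType) (L : fieldExtType rat) (S : {fset (L -> int)})
    (F : (L -> int) -> R) :
  (forall w, w \in S -> is_valuation w) ->
  (forall w, is_valuation w -> w \notin S -> F w = 0) ->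
  \sum_(w \in @finite_places L) F w = \sum_(w <- S) F w.
Proof.
move=> S_val F0.
have sub : [set` S] `<=` @finite_places L by move=> w /= /S_val.
rewrite (@fsbigE _ _ _ _ _ S _ (fset_uniq _) sub); last first.
  by move=> w ww; apply: F0.
rewrite big_seq_cond [RHS]big_seq; apply: eq_bigl => w.
by have [/S_val ww|//] := boolP (w \in S); rewrite mem_set.
Qed.

Lemma places_le_val (L : fieldExtType rat) K (w : L -> int) :
  w \in places_le L K -> is_valuation w.
Proof. by case/places_leP. Qed.

Lemma places_leW (L : fieldExtType rat) K K' (w : L -> int) : (K <= K')%N ->
  w \in places_le L K -> w \in places_le L K'.
Proof.
move=> KK' /places_leP[ww [p [pp pK wp]]]; apply/places_leP; split=> //.
by exists p; split=> //; apply: leq_trans KK'.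
Qed.

(** * Local degrees in logarithmic form *)

Section LogDegrees.
Variable R : realType.
Local Notation lnq := (lnq R).

Lemma lnq_gt0 (L : fieldExtType rat) (w : L -> int) : is_valuation w -> 0 < lnq w.
Proof. by move=> ww; rewrite ln_gt0 // ltr1n residue_card_gt1. Qed.

Lemma ln_prod (I : finType) (f : I -> R) : (forall i, 0 < f i) ->
  ln (\prod_i f i) = \sum_i ln (f i).
Proof.
move=> f0; suff [] : 0 < \prod_i f i /\ ln (\prod_i f i) = \sum_i ln (f i) by [].
elim/big_rec2: _ => [|i y x _ [x0 <-]]; first by rewrite ln1 ltr01.
by split; [rewrite mulr_gt0 | rewrite lnM // posrE].
Qed.

Lemma ln_prod_residue (L : fieldExtType rat) (I : finType) (w : I -> L -> int)
    (e : I -> nat) : (forall i, is_valuation (w i)) ->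
  ln (\prod_i residue_card (w i) ^ e i)%:R = \sum_i (e i)%:R * lnq (w i).
Proof.
move=> ww; have q0 i : 0 < (residue_card (w i))%:R :> R.
  by rewrite ltr0n ltnW // residue_card_gt1.
rewrite natr_prod ln_prod; last by move=> i; rewrite natrX exprn_gt0.
by apply: eq_bigr => i _; rewrite natrX lnXn // [RHS]mulr_natl.
Qed.

Lemma log_local_degrees (L M : fieldExtType rat) (iota : {rmorphism L -> M})
    (v : L -> int) (B : {fset (M -> int)}) (e : (M -> int) -> nat) :
  is_valuation v -> (forall w, w \in B -> is_valuation w) ->
  (forall w c, w \in B -> w (iota c) = (e w)%:Z * v c) ->
  (\dim {:L})%:R * \sum_(w <- B) (e w)%:R * lnq w <= (\dim {:M})%:R * lnq v.
Proof.
move=> vv ww wv.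
have [s [b [_ _ sdim E]]] := local_degrees (w := fun w : B => val w)
  (e := fun w : B => e (val w)) vv (fun w : B => ww _ (valP w)) val_inj
  (fun w c => wv _ c (valP w)).
have := congr1 (fun n => ln (n%:R : R)) E.
rewrite ln_prod_residue; last by move=> w; apply: ww (valP w).
rewrite natrX lnXn; last by rewrite ltr0n ltnW // residue_card_gt1.
rewrite big_seq_fsetE /= => ->; rewrite -[ln _ *+ _]mulr_natl mulrA.
rewrite ler_wpM2r ?(ltW (lnq_gt0 vv)) //.
by rewrite -natrM ler_nat mulnC.
Qed.

Lemma log_degrees_le (L : fieldExtType rat) p : prime p ->
  \sum_(v <- places_at L p) (v p%:R)%:~R * lnq v <= (\dim {:L})%:R * ln p%:R.
Proof.
move=> pp; have [w0 [ww0 w0p]] := place_over_exists L pp.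
have pv := padic_valuation ww0 pp w0p.
have atP w : w \in places_at L p -> is_valuation w /\ 0 < w p%:R by move/places_atP; apply.
have := @log_local_degrees rat^o L (in_alg L) (padic p) (places_at L p)
  (fun w => `|w p%:R|%N) pv (fun w wB => proj1 (atP w wB)).
rewrite /lnq padic_residue_card // {1}dimvf /= /dim /= mul1r => h.
apply: le_trans (h _); last first.
  by move=> w c /atP[ww wp]; rewrite gez0_abs ?ltW //; apply: val_rat.
rewrite big_seq [leRHS]big_seq ler_sum // => w /atP[ww wp].
by rewrite -[in leLHS](gez0_abs (ltW wp)).
Qed.

Lemma log_degrees_eq (M : splittingFieldType rat) p : prime p ->
  \sum_(w <- places_at M p) (w p%:R)%:~R * lnq w = (\dim {:M})%:R * ln p%:R.
Proof.
move=> pp.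
have atP w : w \in places_at M p -> is_valuation w /\ 0 < w p%:R by move/places_atP; apply.
have atE : [set` places_at M p] = @places_over M p.
  by apply/seteqP; split=> w /=; [move/(places_atP _ pp) | move=> h; apply/places_atP].
have := congr1 (fun n => ln (n%:R : R)) (local_degree_sum pp atE).
rewrite ln_prod_residue; last by move=> w; case: (atP _ (valP w)).
rewrite natrX lnXn ?ltr0n ?prime_gt0 // mulr_natl => <-.
rewrite big_seq_fsetE /=; apply: eq_bigr => w _.
by case: (atP _ (valP w)) => _ wp; rewrite -[in LHS](gez0_abs (ltW wp)).
Qed.

Section Fibers.
Variables (L : fieldExtType rat) (M : splittingFieldType rat).
Variable iota : {rmorphism L -> M}.

Lemma restriction_map : exists (e : (M -> int) -> nat) (res : (M -> int) -> L -> int),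
  forall w, is_valuation w ->
  [/\ (0 < e w)%N, is_valuation (res w) & forall x, w (iota x) = (e w)%:Z * res w x].
Proof.
have : forall w : M -> int, exists ev : nat * (L -> int), is_valuation w ->
    [/\ (0 < ev.1)%N, is_valuation ev.2 & forall x, w (iota x) = ev.1%:Z * ev.2 x].
  move=> w; have [ww|nw] := pselect (is_valuation w); last by exists (0%N, fun=> 0).
  by have [e [v h]] := restrict_valuation iota ww; exists (e, v).
by move=> /choice[f hf]; exists (fun w => (f w).1), (fun w => (f w).2).
Qed.

Variables (e : (M -> int) -> nat) (res : (M -> int) -> L -> int).
Hypothesis resP : forall w, is_valuation w ->
  [/\ (0 < e w)%N, is_valuation (res w) & forall x, w (iota x) = (e w)%:Z * res w x].

Lemma res_nat w n : is_valuation w -> (0 < res w n%:R) = (0 < w n%:R).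
Proof.
move=> ww; have [e0 _ wE] := resP ww.
by rewrite -(rmorph_nat iota) wE pmulr_rgt0 // ltz_nat.
Qed.

(* On each fiber [log_local_degrees] gives an inequality; weighted by [u p] and
   summed over the places [u] above [p], these inequalities become equalities by
   [log_degrees_eq] for [M] and [log_degrees_le] for [L]. *)
Lemma sum_fiber p v : prime p -> v \in places_at L p ->
  (\dim {:L})%:R * (\sum_(w <- places_at M p | res w == v) (e w)%:R * lnq w)
    = (\dim {:M})%:R * lnq v.
Proof.
move=> pp vp.
have atP (N : fieldExtType rat) (w : N -> int) :
  w \in places_at N p -> is_valuation w /\ 0 < w p%:R by move/places_atP; apply.
pose T u := \sum_(w <- places_at M p | res w == u) (e w)%:R * lnq w.
have T_le u : u \in places_at L p ->
    (\dim {:L})%:R * T u <= (\dim {:M})%:R * lnq u.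
  move=> up; rewrite /T big_fset_condE.
  apply: (log_local_degrees (iota := iota)); first by case: (atP _ _ up).
    by move=> w; rewrite !inE => /andP[/atP[]].
  move=> w c; rewrite !inE => /andP[/atP[ww _] /eqP <-].
  by have [_ _ ->] := resP ww.
have res_at w : w \in places_at M p -> res w \in places_at L p.
  move=> /atP[ww wp]; apply/places_atP => //.
  by have [_ rv _] := resP ww; rewrite res_nat.
have sumT : \sum_(u <- places_at L p) (u p%:R)%:~R * T u = (\dim {:M})%:R * ln p%:R.
  rewrite -log_degrees_eq // (partition_big_fset _ res_at).
  rewrite big_seq [RHS]big_seq; apply: eq_bigr => u up.
  rewrite /T mulr_sumr big_seq_cond [RHS]big_seq_cond; apply: eq_bigr => w.
  move=> /andP[/atP[ww _] /eqP <-]; have [_ _ wE] := resP ww.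
  by rewrite -(rmorph_nat iota) wE rmorphM /= mulrCA mulrA.
pose D u := (u p%:R)%:~R * ((\dim {:M})%:R * lnq u - (\dim {:L})%:R * T u).
have D_ge0 u : u \in places_at L p -> 0 <= D u.
  move=> up; have [_ up0] := atP _ _ up.
  by rewrite mulr_ge0 ?ler0z ?(ltW up0) // subr_ge0 T_le.
have D_le0 : \sum_(u <- places_at L p) D u <= 0.
  rewrite /D; under eq_bigr do rewrite mulrBr [_ * (_ * lnq _)]mulrCA [_ * (_ * T _)]mulrCA.
  rewrite sumrB -!mulr_sumr sumT subr_le0 mulrCA ler_wpM2l //.
  exact: log_degrees_le.
have : D v = 0.
  apply/eqP; rewrite eq_le D_ge0 // andbT; apply: le_trans D_le0.
  rewrite (big_fsetD1 v) //= lerDl big_seq sumr_ge0 // => u.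
  by rewrite !inE => /andP[_ /D_ge0].
move/eqP; rewrite mulf_eq0 subr_eq0; have [_ vp0] := atP _ _ vp.
by rewrite intr_eq0 gt_eqF //= => /eqP ->.
Qed.

End Fibers.
End LogDegrees.

(** * The finite part of the height and the finite half of the product formula *)

Section FiniteHeight.
Variable R : realType.
Local Notation lnq := (lnq R).

Definition finite_height (L : fieldExtType rat) (x : L) : R :=
  \sum_(w \in @finite_places L) ln (Num.max 1 (place_norm R w x)).

Lemma ln_place_norm (L : fieldExtType rat) (w : L -> int) (x : L) : is_valuation w ->
  ln (Num.max 1 (place_norm R w x)) = (Num.max 0 (- w x))%:~R * lnq w.
Proof.
move=> ww; rewrite /place_norm; have [->|x0] := eqVneq x 0.
  by rewrite val0 // oppr0 maxxx mul0r max_l ?ler01 // ln1.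
have q1 : 1 <= (residue_card w)%:R :> R.
  by rewrite ler1n ltnW // residue_card_gt1.
have q0 : 0 < (residue_card w)%:R :> R by apply: lt_le_trans ltr01 q1.
case: (- w x) => n.
  rewrite max_r; last by rewrite -exprnP exprn_ege1.
  by rewrite -exprnP lnXn // max_r // mulrzl.
rewrite max_l; last by rewrite NegzE -exprnN invf_le1 ?exprn_gt0 // exprn_ege1.
by rewrite ln1 max_l // mul0r.
Qed.

Lemma finite_heightE (L : fieldExtType rat) (x : L) K :
  (forall w, is_valuation w -> w x != 0 -> w \in places_le L K) ->
  finite_height x = \sum_(w <- places_le L K) (Num.max 0 (- w x))%:~R * lnq w.
Proof.
move=> hK; rewrite /finite_height (sum_finite_places (@places_le_val L K)).
  rewrite big_seq [RHS]big_seq; apply: eq_bigr => w /places_le_val ww.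
  exact: ln_place_norm.
move=> w ww wK; rewrite ln_place_norm //.
have -> : w x = 0 by apply: contraNeq wK; apply: hK.
by rewrite oppr0 maxxx mul0r.
Qed.

(** Group the places of [M] by their restriction to [L]. On the fiber of [v] the valuation of
    [iota x] is [e w * v x], and [sum_fiber] evaluates the sum of the weights [e w * lnq w]. *)
Lemma finite_height_extension (L : fieldExtType rat) (M : splittingFieldType rat)
    (iota : {rmorphism L -> M}) (x : L) :
  (\dim {:L})%:R * finite_height (iota x) = (\dim {:M})%:R * finite_height x.
Proof.
have [K1 hK1] := finite_support_valuation x.
have [K2 hK2] := finite_support_valuation (iota x).
pose K := maxn K1 K2.
rewrite (finite_heightE (K := K)); last first.
  by move=> w ww /(hK2 _ ww); apply/places_leW/leq_maxr.
rewrite (finite_heightE (K := K)); last first.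
  by move=> w ww /(hK1 _ ww); apply/places_leW/leq_maxl.
have [e [res resP]] := restriction_map iota.
have res_le w : w \in places_le M K -> res w \in places_le L K.
  move=> /places_leP[ww [p [pp pK wp]]]; have [_ rv _] := resP _ ww.
  by apply/places_leP; split=> //; exists p; split=> //; rewrite (res_nat resP).
rewrite (partition_big_fset _ res_le) !mulr_sumr big_seq [RHS]big_seq.
apply: eq_bigr => v /places_leP[vv [p [pp pK vp]]].
have v_at : v \in places_at L p by apply/places_atP.
rewrite mulrCA -(sum_fiber R resP pp v_at) mulrCA; congr (_ * _).
have -> : \sum_(w <- places_at M p | res w == v) (e w)%:R * lnq w =
          \sum_(w <- places_le M K | res w == v) (e w)%:R * lnq w.
  rewrite big_fset_condE [RHS]big_fset_condE.
  suff -> : [fset w in places_at M p | res w == v]%fset =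
            [fset w in places_le M K | res w == v]%fset by [].
  apply/fsetP => w; rewrite !inE; apply: andb_id2r => /eqP rw.
  apply/(places_atP _ pp)/places_leP => [[ww wp]|[ww _]]; split=> //.
    by exists p.
  by rewrite -(res_nat resP) // rw.
rewrite mulr_sumr big_seq_cond [RHS]big_seq_cond; apply: eq_bigr => w.
move=> /andP[/places_le_val ww /eqP <-]; have [_ _ wE] := resP _ ww.
rewrite wE mulrA; congr (_ * _); rewrite -mulrN.
rewrite -[(e w)%:R]/((e w)%:~R) -intrM mulrC; congr (_%:~R).
by rewrite maxr_pMl // mul0r.
Qed.

(** Minus the logarithm of the product of the finite absolute values of [x]; it turns out to be the
    logarithm of the absolute norm. *)
Definition log_norm (L : fieldExtType rat) (x : L) : R :=
  \sum_(w \in @finite_places L) (w x)%:~R * lnq w.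

Lemma log_normE (L : fieldExtType rat) (x : L) K :
  (forall w, is_valuation w -> w x != 0 -> w \in places_le L K) ->
  log_norm x = \sum_(w <- places_le L K) (w x)%:~R * lnq w.
Proof.
move=> hK; apply: sum_finite_places => [w|w ww wK]; first exact: places_le_val.
have -> : w x = 0 by apply: contraNeq wK; apply: hK.
by rewrite mul0r.
Qed.

Lemma log_normM (L : fieldExtType rat) (x y : L) : x != 0 -> y != 0 ->
  log_norm (x * y) = log_norm x + log_norm y.
Proof.
move=> x0 y0.
have [K1 hK1] := finite_support_valuation x.
have [K2 hK2] := finite_support_valuation y.
have [K3 hK3] := finite_support_valuation (x * y).
pose K := maxn K1 (maxn K2 K3).
rewrite !(log_normE (K := K)).
- rewrite -big_split big_seq [RHS]big_seq; apply: eq_bigr => w /places_le_val ww /=.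
  by rewrite valM // rmorphD mulrDl.
- by move=> w ww /(hK2 _ ww); apply/places_leW; rewrite /K; lia.
- by move=> w ww /(hK1 _ ww); apply/places_leW; rewrite /K; lia.
- by move=> w ww /(hK3 _ ww); apply/places_leW; rewrite /K; lia.
Qed.

Lemma log_norm1 (L : fieldExtType rat) : log_norm (1 : L) = 0.
Proof.
have := log_normM (oner_neq0 L) (oner_neq0 L); rewrite mulr1.
by move: (log_norm _) => a; lra.
Qed.

Lemma log_norm_prod (L : fieldExtType rat) (I : finType) (P : pred I) (f : I -> L) :
  (forall i, f i != 0) -> log_norm (\prod_(i | P i) f i) = \sum_(i | P i) log_norm (f i).
Proof.
move=> f0; suff [] : \prod_(i | P i) f i != 0 /\
  log_norm (\prod_(i | P i) f i) = \sum_(i | P i) log_norm (f i) by [].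
elim/big_rec2: _ => [|i y x _ [x0 <-]]; first by rewrite oner_neq0 log_norm1.
by rewrite mulf_neq0 // log_normM.
Qed.

Lemma log_norm_inv (L : fieldExtType rat) (x : L) : x != 0 ->
  log_norm x^-1 = - log_norm x.
Proof.
move=> x0; have := log_normM x0 (invr_neq0 x0); rewrite mulfV // log_norm1.
by move: (log_norm _) (log_norm _) => a b; lra.
Qed.

Lemma log_normN (L : fieldExtType rat) (x : L) : log_norm (- x) = log_norm x.
Proof.
by apply: eq_fsbigr => w; rewrite inE => ww; rewrite valN.
Qed.

Section Galois.
Variable M : splittingFieldType rat.

Lemma log_norm_gal (g : gal_of {:M}) (x : M) : log_norm (g x) = log_norm x.
Proof.
have gV h : is_valuation h -> is_valuation (h \o (g^-1)%g).
  exact: valuation_gal.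
rewrite /log_norm [RHS](reindex_fsbig (fun w : M -> int => w \o g) (@finite_places M)).
  apply: eq_fsbigr => w; rewrite inE => ww.
  by rewrite /= /lnq residue_card_gal.
split.
- by move=> w; apply: valuation_gal.
- move=> w w' _ _ E; apply/funext => y.
  by have := congr1 (fun h : M -> int => h ((g^-1)%g y)) E; rewrite /= galKV.
- move=> w ww; exists (w \o (g^-1)%g); first exact: valuation_gal.
  by apply/funext => y /=; rewrite -galM ?memvf // mulgV gal_id.
Qed.

Lemma log_norm_prime p : prime p -> log_norm (p%:R : M) = (\dim {:M})%:R * ln p%:R.
Proof.
move=> pp; rewrite -log_degrees_eq //; apply: sum_finite_places.
  by move=> w /places_atP[].
move=> w ww wp; have -> : w p%:R = 0; last by rewrite mul0r.
apply/eqP; apply: contraNT wp => wp0; apply/places_atP => //; split=> //.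
rewrite lt_def wp0 /=; have := vball_nat ww p.
by rewrite vballE // nat_alg_neq0 // prime_gt0.
Qed.

Lemma log_norm_nat m : (0 < m)%N -> log_norm (m%:R : M) = (\dim {:M})%:R * ln m%:R.
Proof.
elim/ltn_ind: m => m IH m0; have [m1|m1] := leqP m 1.
  by rewrite (_ : m = 1%N) ?log_norm1 ?ln1 ?mulr0 //; lia.
have pp := pdiv_prime m1.
have mE : m = (m %/ pdiv m * pdiv m)%N by rewrite divnK ?pdiv_dvd.
have d0 : (0 < m %/ pdiv m)%N by rewrite divn_gt0 ?prime_gt0 // dvdn_leq ?pdiv_dvd.
have dn0 := nat_alg_neq0 M d0; have pn0 := nat_alg_neq0 M (prime_gt0 pp).
have -> : m%:R = (m %/ pdiv m)%:R * (pdiv m)%:R :> M by rewrite -natrM -mE.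
rewrite log_normM // (log_norm_prime pp) IH // ?ltn_Pdiv ?prime_gt1 //.
by rewrite -mulrDr -lnM ?posrE ?ltr0n ?(prime_gt0 pp) // -natrM -mE.
Qed.

Lemma log_norm_rat (r : rat) : r != 0 ->
  log_norm (r%:A : M) = (\dim {:M})%:R * ln `|ratr r|.
Proof.
move=> r0; have n0 : (0 < `|numq r|)%N by rewrite absz_gt0 numq_eq0.
have d0 : (0 < `|denq r|)%N by rewrite absz_gt0 denq_neq0.
have log_int (m : int) : log_norm (m%:~R : M) = log_norm ((`|m|%N)%:R : M).
  have [h|h] := leP 0 m; first by rewrite -{1}(gez0_abs h).
  by rewrite -log_normN -rmorphN -ltz0_abs.
have rA : r%:A = (numq r)%:~R / (denq r)%:~R :> M.
  by rewrite -in_algE -[in LHS](divq_num_den r) fmorph_div !rmorph_int.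
have int0 (m : int) : m != 0 -> m%:~R != 0 :> M.
  by move=> m0; rewrite -(rmorph_int (in_alg M)) fmorph_eq0 intr_eq0.
rewrite rA log_normM ?invr_neq0 ?int0 ?numq_eq0 ?denq_neq0 //.
rewrite log_norm_inv ?int0 ?denq_neq0 // !log_int !log_norm_nat //.
rewrite -mulrBr; congr (_ * _); rewrite -ln_div ?posrE ?ltr0n //; congr ln.
rewrite -[in RHS](divq_num_den r) fmorph_div !rmorph_int normrM normfV.
by rewrite !natr_absz !intr_norm.
Qed.

(* The finite half of the product formula: conjugation permutes the places, so
   averaging over the Galois group reduces it to rational numbers. *)
Lemma log_norm_galNorm (x : M) (r : rat) : x != 0 -> galNorm 1 {:M} x = r%:A ->
  log_norm x = ln `|ratr r|.
Proof.
move=> x0 xr.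
have dimG : #|('Gal({:M} / 1))%g| = \dim {:M}.
  by rewrite -galois_dim ?galois_number_field // dimv1 divn1.
have r0 : r != 0.
  apply: contraNneq x0 => r0; move: xr; rewrite r0 scale0r => /eqP.
  by rewrite galNorm_eq0.
have : log_norm (galNorm 1 {:M} x) = (\dim {:M})%:R * log_norm x.
  rewrite log_norm_prod; last by move=> g; rewrite fmorph_eq0.
  rewrite (eq_bigr (fun=> log_norm x)); last by move=> g _; apply: log_norm_gal.
  by rewrite sumr_const dimG mulr_natl.
rewrite xr log_norm_rat // => /mulfI -> //.
by rewrite pnatr_eq0 -lt0n adim_gt0.
Qed.

End Galois.
End FiniteHeight.

(** * Complex embeddings *)

Lemma rational_poly (L : fieldExtType rat) (p : {poly L}) :
  p \is a polyOver 1%VS -> exists q : {poly rat}, p = map_poly (in_alg L) q.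
Proof. by move=> /polyOver1P[q ->]; exists q. Qed.

Lemma primitive_element (L : fieldExtType rat) : exists theta : L,
  forall x, exists q : {poly rat}, x = (map_poly (in_alg L) q).[theta].
Proof.
have sep : separable 1 {:L}.
  apply/separableP => x _; apply: pcharf0_separable => p.
  by rewrite pchar_lalg pchar_num.
exists (separable_generator 1 {:L}) => x.
have : x \in <<1; separable_generator 1 {:L}>>%VS.
  by rewrite -(eq_adjoin_separable_generator sep (sub1v _)) memvf.
by case/Fadjoin_polyP => p /rational_poly[q ->] ->; exists q.
Qed.

Lemma rmorph_horner_rat (L : fieldExtType rat) (C : numFieldType)
    (s : {rmorphism L -> C}) (q : {poly rat}) (x : L) :
  s (map_poly (in_alg L) q).[x] = (map_poly ratr q).[s x].
Proof.
rewrite -horner_map -map_poly_comp; congr (_.[_]); apply: eq_map_poly => r /=.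
by rewrite rmorphZ_num rmorph1 mulr1.
Qed.

(** A primitive element is sent to a root in [C] of its minimal polynomial. Divisibility by that
    polynomial makes the result independent of the polynomial chosen to represent an element. *)
Lemma exists_embedding (L : fieldExtType rat) (C : numClosedFieldType) :
  exists s : {rmorphism L -> C}, True.
Proof.
have [theta gen] := primitive_element L.
have /choice[P PE] := gen.
have [m mE] := rational_poly (minPolyOver 1%AS theta).
have m1 : size (map_poly (ratr : rat -> C) m) != 1%N.
  rewrite size_map_poly -(size_map_poly (in_alg L)) -mE.
  by rewrite size_minPoly.
have [z mz] := closed_rootP _ m1.
have key q : (map_poly (in_alg L) q).[theta] = 0 -> (map_poly (ratr : rat -> C) q).[z] = 0.
  move=> q0; have : minPoly 1%AS theta %| map_poly (in_alg L) q.
    apply: minPoly_dvdp; last by apply/rootP.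
    by apply/polyOver1P; exists q.
  rewrite mE dvdp_map -(dvdp_map (ratr : {rmorphism rat -> C})) => /dvdpP[t ->].
  by rewrite hornerM (rootP mz) mulr0.
have key2 q1 q2 : (map_poly (in_alg L) q1).[theta] = (map_poly (in_alg L) q2).[theta] ->
    (map_poly (ratr : rat -> C) q1).[z] = (map_poly ratr q2).[z].
  move=> q12; apply/eqP; rewrite -subr_eq0 -hornerN -hornerD -rmorphB.
  by apply/eqP/key; rewrite rmorphB /= hornerD hornerN q12 subrr.
pose s x := (map_poly (ratr : rat -> C) (P x)).[z].
have s_sub : zmod_morphism s.
  move=> x y; transitivity (map_poly (ratr : rat -> C) (P x - P y)).[z].
    by apply: key2; rewrite rmorphB /= hornerD hornerN -!PE.
  by rewrite rmorphB /= hornerD hornerN.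
have s_mul : monoid_morphism s.
  split=> [|x y].
    transitivity (map_poly (ratr : rat -> C) 1).[z]; last by rewrite rmorph1 hornerC.
    by apply: key2; rewrite rmorph1 hornerC -PE.
  transitivity (map_poly (ratr : rat -> C) (P x * P y)).[z].
    by apply: key2; rewrite rmorphM /= hornerM -!PE.
  by rewrite rmorphM /= hornerM.
pose s1 := GRing.isZmodMorphism.Build L C s s_sub.
pose s2 := GRing.isMonoidMorphism.Build L C s s_mul.
pose sR : {rmorphism L -> C} := HB.pack s s1 s2.
by exists sR.
Qed.

Section Embeddings.
Variables (L : fieldExtType rat) (M : splittingFieldType rat).
Variables (iota : {rmorphism L -> M}) (C : numClosedFieldType) (s0 : {rmorphism M -> C}).

(** The minimal polynomial of [iota theta] splits in [M] into factors given by its conjugates, so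
    the root [s theta] is the image under [s0] of one of them. *)
Lemma embedding_conjugate (s : {rmorphism L -> C}) :
  exists g : gal_of {:M}, forall x, s x = s0 (g (iota x)).
Proof.
have [theta gen] := primitive_element L.
have [r [_ _ mE]] := galois_factors (sub1v _) (galois_number_field M) _ (memvf (iota theta)).
have [q qE] := rational_poly (minPolyOver 1%AS (iota theta)).
have q0 : (map_poly (in_alg L) q).[theta] = 0.
  apply: (fmorph_inj iota); rewrite rmorph0 -horner_map -map_poly_comp.
  have -> : map_poly (iota \o in_alg L) q = map_poly (in_alg M) q.
    by apply: eq_map_poly => c /=; rewrite fmorph_numZ rmorph1.
  by rewrite -qE; apply/rootP/root_minPoly.
have : root (map_poly ratr q) (s theta).
  by apply/rootP; rewrite -rmorph_horner_rat q0 rmorph0.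
have -> : map_poly ratr q = map_poly s0 (map_poly (in_alg M) q).
  rewrite -map_poly_comp; apply: eq_map_poly => c /=.
  by rewrite rmorphZ_num rmorph1 mulr1.
rewrite -qE mE rmorph_prod big_map /=.
rewrite (eq_bigr (fun g : gal_of {:M} => 'X - (s0 (g (iota theta)))%:P)); last first.
  by move=> g _; rewrite map_polyXsubC.
rewrite -(big_map (fun g : gal_of {:M} => s0 (g (iota theta))) predT
  (fun y => 'X - y%:P)) root_prod_XsubC => /mapP[g _ sg].
exists g => x; have [p ->] := gen x.
rewrite rmorph_horner_rat sg; apply/esym.
exact: (rmorph_horner_rat (s0 \o g \o iota : {rmorphism L -> C})).
Qed.

Lemma dim_fixing_group (P : {pred gal_of {:M}}) :
  (forall g, P g <-> forall x, g (iota x) = iota x) ->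
  (#|P| * \dim {:L} = \dim {:M})%N.
Proof.
move=> PE; have [theta gen] := primitive_element L.
have iota_horner q : iota (map_poly (in_alg L) q).[theta] =
    (map_poly (in_alg M) q).[iota theta].
  rewrite -horner_map -map_poly_comp; congr (_.[_]); apply: eq_map_poly => c /=.
  by rewrite fmorph_numZ rmorph1.
pose f (x : L) : M := iota x.
have f_lin : linear f by move=> a x y; rewrite /f rmorphD fmorph_numZ.
pose fM := GRing.isLinear.Build rat L M *:%R f f_lin.
pose iL : {linear L -> M} := HB.pack f fM.
pose K : {subfield M} := <<1; iota theta>>%AS.
have KE : (K : {vspace M}) = limg (linfun iL).
  apply/vspaceP => x; apply/Fadjoin_polyP/memv_imgP => [[p /rational_poly[q ->] ->]|].
    exists (map_poly (in_alg L) q).[theta]; rewrite ?memvf // lfunE.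
    exact: esym (iota_horner q).
  move=> [y _ ->]; rewrite lfunE /=; have [q ->] := gen y.
  exists (map_poly (in_alg M) q); last exact: iota_horner.
  by apply/polyOver1P; exists q.
have dimK : \dim K = \dim {:L}.
  rewrite KE limg_dim_eq //; apply/eqP; rewrite capfv -subv0; apply/subvP => x.
  by rewrite memv_ker lfunE /= fmorph_eq0 memv0.
have galKM : galois K {:M}.
  by apply: galoisS (galois_number_field M); rewrite sub1v subvf.
rewrite -dimK -(divnK (field_dimS (subvf K))) (galois_dim galKM); congr (_ * _)%N.
apply: eq_card => g; rewrite gal_kHom ?subvf //.
apply/idP/kAHomP => [/PE gP x|gP].
  rewrite KE => /memv_imgP[y _ ->]; rewrite lfunE /=; exact: gP.
apply/PE => x; apply: gP; rewrite KE; apply/memv_imgP.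
by exists x; rewrite ?memvf // lfunE.
Qed.

End Embeddings.

Section EmbeddingSums.
Variables (R : realType) (L : fieldExtType rat) (M : splittingFieldType rat).
Variables (iota : {rmorphism L -> M}) (s0 : {rmorphism M -> R[i]}).

(** Every embedding of [L] is induced by the same number of automorphisms of [M], namely the order
    of the group fixing [iota L]. *)
Lemma sum_complex_embeddings (F : (L -> R[i]) -> R) :
  (\dim {:L})%:R * \sum_(g : gal_of {:M}) F (s0 \o g \o iota) =
  (\dim {:M})%:R * \sum_(s \in @complex_embeddings R L) F s.
Proof.
pose h (g : gal_of {:M}) : L -> R[i] := s0 \o g \o iota.
have embE : @complex_embeddings R L = range h.
  apply/seteqP; split=> s /=.
    case=> f ->; have [g gE] := embedding_conjugate iota s0 f.
    by exists g => //; apply/funext => x; rewrite gE.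
  by case=> g _ <-; exists (s0 \o g \o iota : {rmorphism L -> R[i]}).
have fin_emb : finite_set (@complex_embeddings R L).
  by rewrite embE; apply: finite_image; apply: finite_finset.
rewrite fsbig_finite // (partition_big_fset (A := index_enum _)
  (B := fset_set (@complex_embeddings R L)) (h := h)); last first.
  by move=> g _; rewrite in_fset_set // inE embE; exists g.
pose P : {pred gal_of {:M}} := fun g => `[< forall x, g (iota x) = iota x >].
have dimP : (#|P| * \dim {:L} = \dim {:M})%N.
  by apply: (dim_fixing_group (iota := iota)) => g; split=> [/asboolP|?]; [|apply/asboolP].
rewrite -dimP natrM [_%:R * _%:R]mulrC -mulrA; congr (_ * _).
rewrite mulr_sumr big_seq [RHS]big_seq; apply: eq_bigr => s.
rewrite in_fset_set // inE embE => -[g0 _ <-].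
rewrite (eq_bigr (fun=> F (h g0))); last by move=> g /eqP <-.
(* A product of automorphisms applies its left factor first, so those inducing the same embedding as
   [g0] are the [g * g0] with [g] fixing [iota L]. *)
rewrite (reindex_inj (mulIg g0)) (eq_bigl (mem P)) ?sumr_const ?mulr_natl // => g.
apply/eqP/asboolP => [E x|gP].
  have := congr1 (fun f => f x) E; rewrite /h /= galM ?memvf //.
  by move=> /fmorph_inj/fmorph_inj.
by apply/funext => x; rewrite /h /= galM ?memvf // gP.
Qed.

End EmbeddingSums.

(** * Properties of the height *)

Section LnPlus.
Variable R : realType.
Implicit Types a b : R.

Definition lnp a : R := ln (Num.max 1 a).

Let max1_gt0 a : 0 < Num.max 1 a. Proof. by rewrite lt_max ltr01. Qed.

Lemma lnp_ge0 a : 0 <= lnp a.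
Proof. by rewrite ln_ge0 // le_max lexx. Qed.

Lemma lnpM a b : 0 <= a -> 0 <= b -> lnp (a * b) <= lnp a + lnp b.
Proof.
move=> a0 b0; rewrite /lnp -lnM ?posrE ?max1_gt0 // ler_ln ?posrE ?mulr_gt0 ?max1_gt0 //.
rewrite ge_max; apply/andP; split; last by rewrite ler_pM // le_max lexx orbT.
by rewrite -[leLHS]mulr1 ler_pM // le_max lexx.
Qed.

Lemma lnpD a b c : 0 <= a -> 0 <= b -> c <= a + b -> lnp c <= ln 2 + (lnp a + lnp b).
Proof.
move=> a0 b0 cab; rewrite /lnp -lnM ?posrE ?max1_gt0 // -lnM ?posrE ?mulr_gt0 ?max1_gt0 //.
rewrite ler_ln ?posrE ?mulr_gt0 ?max1_gt0 //.
have h1 : 1 <= Num.max 1 a by rewrite le_max lexx.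
have h2 : 1 <= Num.max 1 b by rewrite le_max lexx.
have h3 : a <= Num.max 1 a by rewrite le_max lexx orbT.
have h4 : b <= Num.max 1 b by rewrite le_max lexx orbT.
move: (Num.max 1 a) (Num.max 1 b) h1 h2 h3 h4 => x y h1 h2 h3 h4.
by rewrite ge_max; apply/andP; split; nra.
Qed.

Lemma lnpX a k : 0 <= a -> lnp (a ^+ k) = lnp a *+ k.
Proof.
move=> a0; rewrite /lnp -lnXn ?max1_gt0 //; congr ln.
have [a1|a1] := leP a 1; first by rewrite max_l ?exprn_ile1 // expr1n.
by rewrite max_r // exprn_ege1 // ltW.
Qed.

Lemma lnpV a : 0 < a -> lnp a^-1 = lnp a - ln a.
Proof.
move=> a0; rewrite /lnp; have [a1|a1] := leP a 1.
  by rewrite max_r ?invf_ge1 // ln1 sub0r lnV.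
by rewrite max_l ?invf_le1 ?(ltW a1) // ln1 subrr.
Qed.

End LnPlus.

Lemma normc_ge0 (R : realType) (z : R[i]) : 0 <= Normc.normc z.
Proof. by case: z => x y /=; rewrite sqrtr_ge0. Qed.

Lemma normc_gt0 (R : realType) (z : R[i]) : z != 0 -> 0 < Normc.normc z.
Proof.
by move=> z0; rewrite lt_def normc_ge0 andbT; apply: contra_neq z0 => /Normc.eq0_normc.
Qed.

Lemma normc_rat (R : realType) (r : rat) : Normc.normc (ratr r : R[i]) = `|ratr r|.
Proof.
have -> : ratr r = (ratr r : R)%:C%C :> R[i] by rewrite fmorph_rat.
by rewrite /Normc.normc /= expr0n /= addr0 sqrtr_sqr.
Qed.

Section FiniteHeightRules.
Variables (R : realType) (L : fieldExtType rat).
Implicit Types x y : L.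

Lemma finite_height_le x y z :
  (forall w, is_valuation w -> Num.max 0 (- w z) <= Num.max 0 (- w x) + Num.max 0 (- w y)) ->
  finite_height R z <= finite_height R x + finite_height R y.
Proof.
move=> h; have [K1 hK1] := finite_support_valuation x.
have [K2 hK2] := finite_support_valuation y.
have [K3 hK3] := finite_support_valuation z.
pose K := maxn K1 (maxn K2 K3).
rewrite !(finite_heightE R (K := K)).
- rewrite -big_split big_seq [leRHS]big_seq; apply: ler_sum => w /places_le_val ww /=.
  by rewrite -mulrDl ler_wpM2r ?(ltW (lnq_gt0 R ww)) // -rmorphD ler_int h.
- by move=> w ww /(hK2 _ ww); apply/places_leW; rewrite /K; lia.
- by move=> w ww /(hK1 _ ww); apply/places_leW; rewrite /K; lia.
- by move=> w ww /(hK3 _ ww); apply/places_leW; rewrite /K; lia.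
Qed.

Lemma finite_height_ge0 x : 0 <= finite_height R x.
Proof. by apply: fsumr_ge0 => w _; apply: lnp_ge0. Qed.

Lemma finite_heightM x y : finite_height R (x * y) <= finite_height R x + finite_height R y.
Proof.
apply: finite_height_le => w ww.
have [->|x0] := eqVneq x 0; first by rewrite mul0r val0 // oppr0 maxxx; lia.
have [->|y0] := eqVneq y 0; first by rewrite mulr0 val0 // oppr0 maxxx; lia.
by rewrite valM //; lia.
Qed.

Lemma finite_heightD x y : finite_height R (x + y) <= finite_height R x + finite_height R y.
Proof.
apply: finite_height_le => w ww.
have [->|x0] := eqVneq x 0; first by rewrite add0r val0 // oppr0 maxxx; lia.
have [->|y0] := eqVneq y 0; first by rewrite addr0 val0 // oppr0 maxxx; lia.
have [->|xy0] := eqVneq (x + y) 0; first by rewrite val0 //; lia.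
have [_ _ /(_ x y x0 y0 xy0) + _] := ww.
by move: (w x) (w y) (w (x + y)) => a b c; rewrite ge_min => /orP[]; lia.
Qed.

Lemma finite_heightX x k : finite_height R (x ^+ k) = finite_height R x *+ k.
Proof.
have [K1 hK1] := finite_support_valuation x.
rewrite !(finite_heightE R (K := K1)) //.
  rewrite -sumrMnl big_seq [RHS]big_seq; apply: eq_bigr => w /places_le_val ww.
  rewrite -mulrnAl -[_%:~R *+ k]mulr_natr -[k%:R]/(k%:Z%:~R) -intrM valX //.
  by rewrite maxr_pMl // mul0r mulNr.
by move=> w ww; rewrite valX // mulf_eq0 negb_or => /andP[/(hK1 _ ww)].
Qed.

Lemma finite_heightV x : finite_height R x^-1 = finite_height R x + log_norm R x.
Proof.
have [K1 hK1] := finite_support_valuation x.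
rewrite !(finite_heightE R (K := K1)) // ?(log_normE R (K := K1)) //.
  rewrite -big_split big_seq [RHS]big_seq; apply: eq_bigr => w /places_le_val ww /=.
  by rewrite -mulrDl -rmorphD valV //; congr (_%:~R * _); lia.
by move=> w ww; rewrite valV // oppr_eq0; apply: hK1.
Qed.

End FiniteHeightRules.

Section HeightExtension.
Variables (R : realType) (L : fieldExtType rat) (M : splittingFieldType rat).
Variable iota : {rmorphism L -> M}.

Lemma sum_embeddings_gal (s0 : {rmorphism M -> R[i]}) (F : (M -> R[i]) -> R) :
  \sum_(s \in @complex_embeddings R M) F s = \sum_(g : gal_of {:M}) F (s0 \o g).
Proof.
apply: (@mulfI _ (\dim {:M})%:R); first by rewrite pnatr_eq0 -lt0n adim_gt0.
by rewrite -(sum_complex_embeddings (idfun : {rmorphism M -> M}) s0).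
Qed.

Lemma height_in_extension x : height_in R (iota x) = height_in R x.
Proof.
have [s0 _] := exists_embedding M R[i].
have L0 : (\dim {:L})%:R != 0 :> R by rewrite pnatr_eq0 -lt0n adim_gt0.
have M0 : (\dim {:M})%:R != 0 :> R by rewrite pnatr_eq0 -lt0n adim_gt0.
rewrite /height_in -!/(finite_height R _); apply/eqP.
rewrite eqr_div // mulrDl mulrDl [X in _ + X]mulrC finite_height_extension.
rewrite [X in _ == _ + X]mulrC (sum_embeddings_gal s0); apply/eqP; congr (_ + _).
rewrite mulrC [RHS]mulrC.
exact: (sum_complex_embeddings iota s0
  (fun s => ln (Num.max 1 (Normc.normc (s x))))).
Qed.

End HeightExtension.

Section HeightRules.
Variables (R : realType) (M : splittingFieldType rat).
Implicit Types x y : M.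

Lemma height_inE (s0 : {rmorphism M -> R[i]}) x : height_in R x =
  (\sum_(g : gal_of {:M}) lnp (Normc.normc (s0 (g x))) + finite_height R x) / (\dim {:M})%:R.
Proof. by rewrite /height_in (sum_embeddings_gal s0). Qed.

Let dim_gt0 : 0 < (\dim {:M})%:R :> R.
Proof. by rewrite ltr0n adim_gt0. Qed.

Let mem_galT (g : gal_of {:M}) : g \in ('Gal({:M} / 1))%g.
Proof.
by rewrite gal_kHom ?sub1v //; apply/kAHomP => x /vlineP[r ->]; rewrite gal_fixes_rat.
Qed.

Let cardG : #|{: gal_of {:M}}| = \dim {:M}.
Proof.
have -> : #|{: gal_of {:M}}| = #|('Gal({:M} / 1))%g|.
  by apply: eq_card => g; rewrite inE mem_galT.
by rewrite -galois_dim ?galois_number_field // dimv1 divn1.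
Qed.

Lemma height_in_ge0 x : 0 <= height_in R x.
Proof.
have [s0 _] := exists_embedding M R[i].
rewrite (height_inE s0) divr_ge0 ?(ltW dim_gt0) // addr_ge0 ?finite_height_ge0 //.
by rewrite sumr_ge0 // => g _; apply: lnp_ge0.
Qed.

Lemma height_inM x y : height_in R (x * y) <= height_in R x + height_in R y.
Proof.
have [s0 _] := exists_embedding M R[i].
rewrite !(height_inE s0) -mulrDl ler_wpM2r ?invr_ge0 ?(ltW dim_gt0) //.
rewrite addrACA lerD ?finite_heightM // -big_split ler_sum // => g _ /=.
by rewrite !rmorphM Normc.normcM lnpM ?normc_ge0.
Qed.

Lemma height_inD x y : height_in R (x + y) <= ln 2 + (height_in R x + height_in R y).
Proof.
have [s0 _] := exists_embedding M R[i].
(* One [ln 2] for each complex embedding; the ultrametric finite places contribute none. *)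
have -> : ln 2 = (\dim {:M})%:R * ln 2 / (\dim {:M})%:R :> R.
  by rewrite mulrAC mulfV ?mul1r // gt_eqF.
rewrite !(height_inE s0) -!mulrDl ler_wpM2r ?invr_ge0 ?(ltW dim_gt0) //.
rewrite addrACA [leRHS]addrA lerD ?finite_heightD // -cardG mulr_natl -sumr_const.
rewrite -!big_split ler_sum // => g _ /=.
by apply: lnpD; rewrite ?normc_ge0 // !rmorphD le_normcD.
Qed.

Lemma height_inX x k : height_in R (x ^+ k) = height_in R x *+ k.
Proof.
have [s0 _] := exists_embedding M R[i].
rewrite !(height_inE s0) finite_heightX -mulrnAl mulrnDl.
congr ((_ + _) / _); rewrite -sumrMnl; apply: eq_bigr => g _; rewrite !rmorphXn /=.
rewrite -lnpX ?normc_ge0 //; congr lnp.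
by elim: k => [|k IH]; rewrite ?expr0 ?Normc.normc1 // !exprS Normc.normcM IH.
Qed.

(** Inversion changes the archimedean part by minus the logarithm of the absolute norm and the
    finite part by plus the same quantity: the product formula. *)
Lemma height_inV x : height_in R x^-1 = height_in R x.
Proof.
have [->|x0] := eqVneq x 0; first by rewrite invr0.
have [s0 _] := exists_embedding M R[i].
rewrite !(height_inE s0) finite_heightV; congr (_ / _).
have [r xr] := norm_rational x.
rewrite (log_norm_galNorm R x0 xr) [finite_height R x + _]addrC addrA; congr (_ + _).
have n0 (g : gal_of {:M}) : 0 < Normc.normc (s0 (g x)).
  by rewrite normc_gt0 // !fmorph_eq0.
have -> : `|ratr r : R| = \prod_(g : gal_of {:M}) Normc.normc (s0 (g x)).
  rewrite -normc_rat.
  have -> : ratr r = s0 (galNorm 1 {:M} x) by rewrite xr rmorphZ_num rmorph1 mulr1.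
  rewrite /galNorm rmorph_prod (big_morph _ (@Normc.normcM R) (Normc.normc1 R)).
  by apply: eq_bigl => g; rewrite mem_galT.
rewrite ln_prod // -big_split; apply: eq_bigr => g _ /=.
by rewrite !fmorphV Normc.normcV lnpV ?n0 // subrK.
Qed.

Lemma height_in1 : height_in R (1 : M) = 0.
Proof. by have := height_inX 1 0; rewrite expr0 mulr0n. Qed.

Lemma height_inN x : height_in R (- x) <= height_in R x.
Proof.
have hN1 : height_in R (-1 : M) = 0.
  have := height_inX (-1) 2; rewrite sqrrN expr1n height_in1.
  by rewrite mulr2n; move: (height_in _ _) => a; lra.
by rewrite -mulN1r; apply: le_trans (height_inM _ _) _; rewrite hN1 add0r.
Qed.

End HeightRules.

(** * From algebraic numbers to a Galois number field *)

(** [num_field_exists] is applied to all roots of a product of minimal polynomials, so that the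
    field it returns is a splitting field. *)
Lemma normal_closure (s : seq algC) :
  exists (M : splittingFieldType rat) (J : {rmorphism M -> algC}),
    forall a, a \in s -> exists b, J b = a.
Proof.
have [q q0 qs] : exists2 q : {poly rat}, q != 0 &
    forall a, a \in s -> root (map_poly ratr q) a.
  elim: s => [|a s [q q0 qs]]; first by exists 1; rewrite ?oner_neq0.
  have [p [_ p_monic] pP] := minCpolyP a.
  exists (p * q); first by rewrite mulf_neq0 // monic_neq0.
  move=> c; rewrite inE rmorphM rootM => /predU1P[->|/qs ->]; last by rewrite orbT.
  by rewrite pP dvdpp.
have [rs rsE] := closed_field_poly_normal (map_poly (ratr : rat -> algC) q).
have [L [J [s1 s1E gen]]] := num_field_exists rs.
have lead0 : lead_coef q != 0 by rewrite lead_coef_eq0.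
have qE : map_poly (in_alg L) q =
    (lead_coef q)%:A *: \prod_(y <- s1) ('X - y%:P).
  apply: (map_poly_inj J); rewrite -map_poly_comp map_polyZ rmorph_prod /=.
  rewrite rmorphZ_num rmorph1 mulr1.
  have -> : map_poly (J \o in_alg L) q = map_poly ratr q.
    by apply: eq_map_poly => c /=; rewrite rmorphZ_num rmorph1 mulr1.
  rewrite rsE lead_coef_map -s1E big_map; congr (_ *: _).
  by apply: eq_bigr => y _; rewrite map_polyXsubC.
have L_ax : FieldExt_isSplittingField _ L.
  constructor; exists (map_poly (in_alg L) q); first by apply/polyOver1P; exists q.
  exists s1 => //; rewrite qE eqp_scale // scaler_eq0 oner_eq0 orbF.
  exact: lead0.
exists (HB.pack_for (splittingFieldType rat) L L_ax), J => a /qs.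
rewrite rsE rootZ ?lead_coef_eq0 ?map_poly_eq0 // -s1E root_prod_XsubC.
by case/mapP => b _ ->; exists b.
Qed.

Lemma factor_embedding (L M : fieldExtType rat) (j : {rmorphism L -> algC})
    (J : {rmorphism M -> algC}) : (forall x, exists y, J y = j x) ->
  exists iota : {rmorphism L -> M}, forall x, J (iota x) = j x.
Proof.
move=> /choice[f fE].
have f_sub : zmod_morphism f.
  by move=> x y; apply: (fmorph_inj J); rewrite rmorphB !fE rmorphB.
have f_mul : monoid_morphism f.
  split=> [|x y]; apply: (fmorph_inj J); first by rewrite fE !rmorph1.
  by rewrite rmorphM !fE rmorphM.
pose f1 := GRing.isZmodMorphism.Build L M f f_sub.
pose f2 := GRing.isMonoidMorphism.Build L M f f_mul.
pose fR : {rmorphism L -> M} := HB.pack f f1 f2.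
by exists fR.
Qed.

(** The field chosen inside [height] is generated by the number itself, hence embeds into [M]
    compatibly with [J], and [height_in_extension] applies. *)
Lemma heightE (R : realType) (M : splittingFieldType rat)
    (J : {rmorphism M -> algC}) (b : M) : height R (J b) = height_in R b.
Proof.
rewrite /height; case: (num_field_exists _) => L [j [s sE gen]] /=.
case: s sE gen => [|a [|//]] //= [ja]; rewrite span_seq1 => gen.
have [|iota iotaE] := @factor_embedding L M j J.
  move=> x; have : x \in <<1; a>>%VS by rewrite gen memvf.
  case/Fadjoin_polyP => p /rational_poly[q ->] ->.
  exists (map_poly (in_alg M) q).[b].
  by rewrite !rmorph_horner_rat ja.
rewrite -(height_in_extension R iota); congr (height_in R _).
by apply: (fmorph_inj J); rewrite iotaE.
Qed.

(** * Relations in groups of rank one *)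

Section Torsion.
Local Open Scope quotient_scope.
Variable A : zmodType.

(* [Quotient.quot eventually_zero] contains the colimit of [A -> A -> A -> ...] along
   multiplication by 1, 2, 3, ..., a model of the tensor product of [A] with
   the rationals. *)
Definition eventually_zero : {pred nat -> A} :=
  fun f => `[< exists K, forall k, (K <= k)%N -> f k = 0 >].

Lemma eventually_zero_zmod_closed : zmod_closed eventually_zero.
Proof.
split; first by apply/asboolP; exists 0%N.
move=> f g /asboolP[K hK] /asboolP[K' hK']; apply/asboolP.
exists (maxn K K') => k; rewrite geq_max => /andP[Kk Kk'].
have -> : (f - g) k = f k - g k by [].
by rewrite hK // hK' // subr0.
Qed.

HB.instance Definition _ :=
  GRing.isZmodClosed.Build (nat -> A) eventually_zero eventually_zero_zmod_closed.

(** Represents [x] tensor [q]: the entry at stage [k] is [q * k!] times [x], to be read with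
    denominator [k!]. The division is exact once [k] reaches the denominator of [q]; earlier entries
    are junk that the quotient ignores. *)
Definition scale_fact (x : A) (q : rat) : nat -> A :=
  fun k => x *~ (numq q * (k`! %/ `|denq q|)%N%:Z).

Lemma fact_coefE (q : rat) k : (`|denq q| <= k)%N ->
  (numq q * (k`! %/ `|denq q|)%N%:Z)%:~R = q * (k`!)%:R.
Proof.
move=> qk; have d0 : (0 < `|denq q|)%N by rewrite absz_gt0 denq_neq0.
have dv : (`|denq q| %| k`!)%N by rewrite dvdn_fact // d0.
rewrite rmorphM /= numqE -mulrA; congr (_ * _).
rewrite -{2}(divnK dv) natrM mulrC; congr (_ * _).
by rewrite -[in LHS]absz_denq.
Qed.

(** The universal property sends [t z 1] to the class of the sequence [k! * z]. If this class is
    zero, some [K!] kills [z]. *)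
Lemma tensor_torsion (V : lmodType rat) (t : A -> rat -> V) (z : A) :
  is_tensor_rat t -> t z 1 = 0 -> exists2 N : nat, (0 < N)%N & z *+ N = 0.
Proof.
move=> [_ _ univ] tz0.
pose Q := Quotient.quot eventually_zero.
have piD f g : \pi_Q (f + g) = \pi_Q f + \pi_Q g by exact: Quotient.pi_add.
have piE f g : (\pi_Q f == \pi_Q g) = (f - g \in eventually_zero).
  by rewrite Quotient.idealrBE.
pose b x q : Q := \pi_Q (scale_fact x q).
have [|f [fE _]] := univ _ b.
  split=> [x y q|x q r].
    rewrite /b -piD; congr (\pi_Q _); apply/funext => k.
    exact: mulrzDl.
  apply/eqP; rewrite /b -piD piE; apply/asboolP.
  exists (maxn `|denq (q + r)| (maxn `|denq q| `|denq r|))%N => k.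
  rewrite !geq_max => /and3P[k1 k2 k3].
  have -> : (scale_fact x (q + r) - (scale_fact x q + scale_fact x r)) k =
    scale_fact x (q + r) k - (scale_fact x q k + scale_fact x r k) by [].
  rewrite /scale_fact -mulrzDr -mulrzBr.
  set c := (X in x *~ X); suff -> : c = 0 by rewrite mulr0z.
  apply: (@intr_inj rat).
  by rewrite /c rmorphB rmorphD /= !fact_coefE // mulrDl subrr.
have := fE z 1; rewrite tz0 raddf0 => /esym/eqP.
have -> : (0 : Q) = \pi_Q 0 by apply/eqP; rewrite -(inj_eq (addrI (\pi_Q 0))) addr0 -piD addr0.
rewrite /b piE subr0.
move=> /asboolP[K /(_ K (leqnn K)) E]; exists K`!; first exact: fact_gt0.
by move: E; rewrite /scale_fact (_ : numq 1 = 1) // (_ : denq 1 = 1) // absz1 divn1 mul1r.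
Qed.

(** If [x] tensor 1 vanishes, [x] is torsion. Otherwise it spans [V], so [y] tensor 1 is a rational
    multiple [k] of it, and clearing the denominator of [k] leaves a torsion element. *)
Lemma rank_one_relation (x y : A) : has_rank A 1 ->
  exists m n : int, (m, n) != (0, 0) /\ x *~ m = y *~ n.
Proof.
move=> [V [t [tT dimV]]]; have [[tD _] tZ _] := tT.
have tadd : zmod_morphism (fun z => t z 1).
  move=> u v /=; apply/eqP; rewrite eq_sym subr_eq -tD subrK //.
pose ta := GRing.isZmodMorphism.Build A V (fun z => t z 1) tadd.
pose tA : {additive A -> V} := HB.pack (fun z => t z 1) ta.
have [tx0|tx0] := eqVneq (t x 1) 0.
  have [N N0 xN] := tensor_torsion tT tx0.
  exists N%:Z, 0; rewrite mulr0z -pmulrn xN; split=> //.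
  by rewrite xpair_eqE eqz_nat andbT -lt0n.
set u := t x 1 in tx0 *.
have : t y 1 \in <[u]>%VS.
  suff -> : <[u]>%VS = fullv by apply: memvf.
  by apply/eqP; rewrite eqEdim subvf dimV dim_vline tx0.
case/vlineP => k tyk.
have : t (y *~ denq k - x *~ numq k) 1 = 0.
  rewrite -[t _ 1]/(tA _) raddfB !raddfMz /= tyk.
  by rewrite -/u -!scaler_int scalerA mulrC -numqE scalerN subrr.
move=> /(tensor_torsion tT)[N N0]; rewrite mulrnBl => /eqP; rewrite subr_eq0 => /eqP E.
exists (numq k * N%:Z), (denq k * N%:Z); split.
  by rewrite xpair_eqE negb_and orbC mulf_neq0 ?denq_neq0 // eqz_nat -lt0n.
by rewrite !mulrzA -!pmulrn.
Qed.

End Torsion.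

(** * Points with a multiplicative relation on a line *)

Section Relation.
Variables (R : realType) (M : splittingFieldType rat).
Local Notation h := (height_in R).

Lemma height_inXz (x : M) (m : int) : h (x ^ m) = `|m|%:~R * h x.
Proof.
have nat_case k : h (x ^+ k) = k%:R * h x by rewrite height_inX mulr_natl.
by case: m => k; rewrite ?NegzE -?exprnN ?height_inV nat_case.
Qed.

Lemma height_affine (a b x : M) : h (a + b * x) <= ln 2 + (h a + (h b + h x)).
Proof. by apply: le_trans (height_inD _ _ _) _; rewrite !lerD2l height_inM. Qed.

(* For [x ^ m = y ^ n] the heights of [x], [y] and [x / y] are proportional to
   [|n|], [|m|] and [|n - m|]. *)
Lemma height_relation (x y : M) (m n : int) : x != 0 -> y != 0 -> (m, n) != (0, 0) ->
  x ^ m = y ^ n ->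
  [\/ h x = h y + h (x / y), h y = h x + h (x / y) | h (x / y) = h x + h y].
Proof.
move=> x0 y0 mn0 xy.
have E1 : `|m|%:~R * h x = `|n|%:~R * h y by rewrite -!height_inXz xy.
have E2 : `|m|%:~R * h (x / y) = `|n - m|%:~R * h y.
  by rewrite -!height_inXz expfzMl xy expfzDr // exprz_inv.
have E3 : `|n|%:~R * h (x / y) = `|n - m|%:~R * h x.
  rewrite -!height_inXz expfzMl exprz_inv -invr_expz -xy expfzDr // -invr_expz //.
have {}mn0 : (0 < `|m|) || (0 < `|n|).
  by move: mn0; rewrite xpair_eqE negb_and !normr_gt0.
set p := `|m| in E1 E2 mn0; set q := `|n| in E1 E3 mn0; set r := `|n - m| in E2 E3.
have p0 : 0 <= p by rewrite /p.
have q0 : 0 <= q by rewrite /q.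
(* Among [|m|], [|n|] and [|n - m|] the largest is the sum of the other two; its position selects
   the alternative. *)
have [c|[c|c]] : q = p + r \/ (p = q + r \/ r = p + q) by rewrite /p /q /r; lia.
all: clearbody p q r.
- rewrite {}c rmorphD /= in E1 E3 mn0; constructor 1.
  (* When the common factor vanishes nothing can be cancelled: [m = 0] makes [y] a root of unity, of
     height 0, and [E3] then compares [x] with [x / y]. *)
  have [p0'|pn0] := eqVneq p 0.
    have rn0 : r%:~R != 0 :> R by rewrite intr_eq0; move: mn0; rewrite p0'; lia.
    rewrite p0' /= mul0r ?add0r in E1 E2 E3; have /eqP := esym E1.
    rewrite mulf_eq0 (negPf rn0) /= => /eqP ->; rewrite add0r.
    by apply: (mulfI rn0).
  by apply: (@mulfI _ p%:~R); rewrite ?intr_eq0 // mulrDr E2 E1 mulrDl.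
- rewrite {}c rmorphD /= in E1 E2 mn0; constructor 2.
  have [q0'|qn0] := eqVneq q 0.
    have rn0 : r%:~R != 0 :> R by rewrite intr_eq0; move: mn0; rewrite q0'; lia.
    rewrite q0' /= mul0r ?add0r in E1 E2 E3; have /eqP := E1.
    rewrite mulf_eq0 (negPf rn0) /= => /eqP ->; rewrite add0r.
    by apply: (mulfI rn0).
  by apply: (@mulfI _ q%:~R); rewrite ?intr_eq0 // mulrDr E3 -E1 mulrDl.
- rewrite {}c rmorphD /= in E2 E3; constructor 3.
  have [p0'|pn0] := eqVneq p 0.
    have qn0 : q%:~R != 0 :> R by rewrite intr_eq0; move: mn0; rewrite p0'; lia.
    rewrite p0' /= mul0r ?add0r in E1 E2 E3; have /eqP := esym E1.
    rewrite mulf_eq0 (negPf qn0) /= => /eqP ->; rewrite addr0.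
    by apply: (mulfI qn0).
  by apply: (@mulfI _ p%:~R); rewrite ?intr_eq0 // mulrDr E2 mulrDl E1 addrC.
Qed.

Lemma height_le_of_relation (a b xi : M) (m n : int) :
  a != 0 -> b != 0 -> a != b -> 1 + a * xi != 0 -> 1 + b * xi != 0 ->
  (m, n) != (0, 0) -> (1 + a * xi) ^ m = (1 + b * xi) ^ n ->
  h xi <= h a * 3 + h b * 4 + ln 2 * 5.
Proof.
move=> a0 b0 ab x0 y0 mn0 xy; have rel := height_relation x0 y0 mn0 xy.
have h1 : h (1 : M) = 0 := height_in1 R M.
have hx : h (1 + a * xi) <= ln 2 + (h a + h xi).
  by have := height_affine 1 a xi; rewrite h1 add0r.
have hy : h (1 + b * xi) <= ln 2 + (h b + h xi).
  by have := height_affine 1 b xi; rewrite h1 add0r.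
have hsub (c : M) : c != 0 -> h xi <= ln 2 + (h c + h (1 + c * xi)).
  move=> c0; have {1}-> : xi = c^-1 * (-1 + (1 + c * xi)).
    by rewrite addKr mulKf.
  have := height_inM R c^-1 (-1 + (1 + c * xi)).
  have := height_inD R (-1) (1 + c * xi); have := height_inN R (1 : M).
  by rewrite height_inV h1; lra.
have := hsub a a0; have := hsub b b0; rewrite -/h.
move: hx hy rel; set x := 1 + a * xi; set y := 1 + b * xi => hx hy rel hby hax.
pose t := x / y; rewrite -/t in rel.
have ba0 : b - a != 0 by rewrite subr_eq0 eq_sym.
have hab : h (a / b) <= h a + h b.
  by apply: le_trans (height_inM _ _ _) _; rewrite height_inV.
have hba : h ((b - a) / b) <= ln 2 + (h a + h b).
  have -> : (b - a) / b = 1 + (-1) * (a / b) by field.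
  have := height_affine 1 (-1) (a / b); have := height_inN R (1 : M); rewrite h1; lra.
(* Eliminating [xi] expresses [t] as a fractional linear function of [y] with coefficients built
   from [a] and [b]; as [a != b] it can be inverted, which bounds the heights of [t] and [y] by each
   other. *)
have tE : t = a / b + (b - a) / b * y^-1.
  by rewrite /t /x /y; field; rewrite b0 y0.
have ht : h t <= ln 2 + ((h a + h b) + ((ln 2 + (h a + h b)) + h y)).
  rewrite tE; have := height_affine (a / b) ((b - a) / b) y^-1; rewrite height_inV; lra.
have hty : h y <= ln 2 + ((h a + h b) + ((ln 2 + (h a + h b)) + h t)).
  have tab : t - a / b != 0.
    by rewrite tE addrC addKr !mulf_neq0 ?invr_neq0.
  have yE : y = (b - a) / b * (- (a / b) + t)^-1.
    by rewrite tE addKr [(_ * y^-1)^-1]invfM invrK mulrA mulfV ?mul1r ?mulf_neq0 ?invr_neq0.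
  rewrite {1}yE; have := height_inM R ((b - a) / b) (- (a / b) + t)^-1.
  have := height_inD R (- (a / b)) t; have := height_inN R (a / b).
  by rewrite height_inV; lra.
have ha := height_in_ge0 R a; have hb := height_in_ge0 R b.
(* The constants 3, 4, 5 come from the case [h x = h y + h t], which gives
   [h y <= 4 ln 2 + 3 h a + 3 h b]; then [hby] passes to [xi]. The other two cases bound [h x] by
   [2 ln 2 + 2 h a + 2 h b], and [hax] concludes. *)
by case: rel; lra.
Qed.

End Relation.

Lemma relation_of_rank_one (G : set algC) (x y : algC) :
  mul_subgroup_of_rank 1 G -> G x -> G y ->
  [/\ x != 0, y != 0 & exists m n : int, (m, n) != (0, 0) /\ x ^ m = y ^ n].
Proof.
move=> [A [e [e0 eD e_inj <- rk]]] [u _ <-] [v _ <-]; split=> //.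
have [m [n [mn0 uv]]] := rank_one_relation u v rk; exists m, n; split=> //.
have e00 : e 0 = 1 by apply: (mulfI (e0 0)); rewrite -eD addr0 mulr1.
have eMn z k : e (z *+ k) = e z ^+ k.
  by elim: k => [|k IH]; rewrite ?mulr0n // mulrS eD IH exprS.
have eN z : e (- z) = (e z)^-1.
  by apply: (mulfI (e0 z)); rewrite -eD subrr mulfV.
have eMz z (k : int) : e (z *~ k) = e z ^ k.
  by case: k => k; [exact: eMn | rewrite NegzE mulrNz eN eMn].
by rewrite -!eMz uv.
Qed.

Unset Implicit Arguments.
Set Strict Implicit.

Theorem corollary1p3 (R : realType) (K : set algC) (hK : number_field K)
  (a1 a2 a3 : algC) (ha1 : K a1) (ha2 : K a2) (ha3 : K a3)
  (a1_neq0 : a1 != 0) (a2_neq0 : a2 != 0) (a3_neq0 : a3 != 0)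
  (a12 : a1 != a2) (a13 : a1 != a3) (a23 : a2 != a3)
  (xi : algC) (G : set algC) (hG : mul_subgroup_of_rank 1 G)
  (hG1 : G (1 + a1 * xi)) (hG2 : G (1 + a2 * xi)) (hG3 : G (1 + a3 * xi)) :
  let H : R := height R a1 + height R a2 + height R a3 in
  let D : nat := degree (adjoin K xi) in
  ((totally_real R (adjoin K xi) \/ (D <= 3)%N) ->
     height R xi < 2708%:R * (H + 1)) /\
  (~ (totally_real R (adjoin K xi) \/ (D <= 3)%N) ->
     height R xi < 166%:R * D%:R ^+ 3 * (ln D%:R + 5%:R / 2%:R) * (H + 1)).
Proof.
move=> H D.
have [x0 y0 [m [n [mn0 xy]]]] := relation_of_rank_one hG hG1 hG2.
have [M [J JP]] := normal_closure [:: xi; a1; a2; a3].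
have [|b Jb] := JP xi; first by rewrite !inE eqxx.
have [|b1 Jb1] := JP a1; first by rewrite !inE eqxx orbT.
have [|b2 Jb2] := JP a2; first by rewrite !inE eqxx !orbT.
have [|b3 Jb3] := JP a3; first by rewrite !inE eqxx !orbT.
have Jlin c : J (1 + c * b) = 1 + J c * J b by rewrite rmorphD rmorph1 rmorphM.
have Jxz z (k : int) : J (z ^ k) = J z ^ k by rewrite fmorphXz.
have bound : height R xi <= height R a1 * 3 + height R a2 * 4 + ln 2 * 5.
  rewrite -Jb -Jb1 -Jb2 !heightE; apply: (@height_le_of_relation _ _ _ _ _ m n) => //.
  - by rewrite -(fmorph_eq0 J) Jb1.
  - by rewrite -(fmorph_eq0 J) Jb2.
  - by rewrite -(inj_eq (fmorph_inj J)) Jb1 Jb2.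
  - by rewrite -(fmorph_eq0 J) Jlin Jb Jb1.
  - by rewrite -(fmorph_eq0 J) Jlin Jb Jb2.
  - by apply: (fmorph_inj J); rewrite !Jxz !Jlin Jb Jb1 Jb2.
have h1 : 0 <= height R a1 by rewrite -Jb1 heightE height_in_ge0.
have h2 : 0 <= height R a2 by rewrite -Jb2 heightE height_in_ge0.
have h3 : 0 <= height R a3 by rewrite -Jb3 heightE height_in_ge0.
(* With this, [bound] is at most [3 h(a1) + 4 h(a2) + 5], well below [2708 (H + 1)]. *)
have ln2 : ln 2 <= 1 :> R by apply: (@le_ln1Dx R 1); lra.
have hH : height R xi < 2708%:R * (H + 1) by rewrite /H; lra.
split=> // /not_orP[_ /negP]; rewrite -ltnNge => D4.
have D4R : 4 <= D%:R :> R by rewrite ler_nat.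
have lnD : 0 <= ln D%:R :> R by rewrite ln_ge0 //; lra.
have D3 : 64 <= D%:R ^+ 3 :> R.
  have -> : 64 = 4 ^+ 3 :> R by rewrite -natrX.
  by rewrite lerXn2r ?nnegrE //; lra.
(* For [D >= 4] the coefficient is at least [166 * 64 * 5 / 2 = 26560], which exceeds 2708. *)
apply: lt_le_trans hH _; rewrite ler_wpM2r //; first by rewrite /H; lra.
by nra.
Qed.
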